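(* Let $p,n\in\mathbb{N}$. Suppose $\mathscr{A}_{\mathcal{H}}\asymp\log\left(e|\widetilde{\mathscr{V}}_{\mathcal{H}}|\right)$ and assume further $\log(1+p\mathscr{A}_{\mathcal{H}})\le\frac n2$. Let $\mathcal{S}=\{s\in[p]: s\ge\sqrt{p\mathscr{A}_{\mathcal{H}}}\}$ and $$\psi_{\text{adapt}}(p,s,n)^2 := \begin{cases}\frac sn\log\left(1+\frac{p\mathscr{A}_{\mathcal{H}}}{s^2}\right)\vee s\,\Gamma_{\mathcal{H}}(s,\mathscr{A}_{\mathcal{H}}) & \text{if } s<\sqrt{p\mathscr{A}_{\mathcal{H}}},\\ s\,\Gamma_{\mathcal{H}}(s,\mathscr{A}_{\mathcal{H}}) & \text{if } s\ge\sqrt{p\mathscr{A}_{\mathcal{H}}}.\end{cases}$$ If $\eta\in(0,1)$, then there exists $c_\eta>0$ depending only on $\eta$ such that for all $0<c<c_\eta$ we have $$\inf_\varphi\left\{P_0\{\varphi\ne0\}+\max_{s\in\mathcal{S}}\ \sup_{\substack{f\in\mathcal{F}_s,\\ \|f\|_2\ge c\,\psi_{\text{adapt}}(p,s,n)}}P_f\{\varphi\ne1\}\right\}\ge1-\eta.$$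
   Context: Notation: $[p]=\{1,\dots,p\}$, $a\vee b=\max\{a,b\}$, $a\wedge b=\min\{a,b\}$; $a\asymp b$ means $C^{-1}b\le a\le Cb$ for a universal constant $C>0$; $|A|$ is the cardinality of a finite set $A$. Model: one observes the $p$-dimensional Gaussian white noise model $dY_x = f(x)\,dx + \frac{1}{\sqrt n}\,dB_x$, $x\in[0,1]^p$. $P_f$ denotes the law of the observation when the signal is $f$, and $P_0$ the law when $f\equiv 0$. The infimum is over all tests $\varphi$, i.e. measurable functions of the observation with values in $\{0,1\}$. $\|\cdot\|_2$ is the $L^2([0,1]^p)$ norm. Function space: $\mathcal{H}\subset L^2([0,1])$ is a reproducing kernel Hilbert space (RKHS) whose kernel admits a Mercer expansion. Let $\mathbf 1$ be the constant function one and $\mathcal{H}_0 := \mathcal{H}\cap \mathrm{span}\{\mathbf 1\}^\perp$ (orthogonality in $L^2([0,1])$), also an RKHS, with eigenfunctions $\{\psi_k\}_{k\ge1}$ orthonormal in $L^2([0,1])$ and corresponding eigenvalues $\mu_1\ge\mu_2\ge\dots\ge0$ in the Mercer expansion of its kernel, so that $\|g\|_{\mathcal{H}_0}^2=\sum_{k\ge1}\mu_k^{-1}\langle g,\psi_k\rangle_{L^2}^2$. It is assumed that $\mu_1=1$. Parameter space: for $S\subset[p]$, $\mathcal{H}_S := \{f(x)=\sum_{j\in S} f_j(x_j): f_j\in\mathcal{H}_0,\ \|f_j\|_{\mathcal{H}_0}\le 1 \text{ for all } j\in S\}$, and $\mathcal{F}_s := \bigcup_{S\subset[p],\,|S|\le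 s}\mathcal{H}_S$. Adaptation quantities: for $a>0$ and $s\in[p]$, $\nu_{\mathcal{H}}(s,a)$ is the smallest positive integer $\nu$ satisfying $\mu_\nu\le\frac{\sqrt{\nu\log(1+pa/s^2)}}{n}$, and $\Gamma_{\mathcal{H}}(s,a):=\max_{\nu\in\mathbb{N}}\left\{\mu_\nu\wedge\frac{\sqrt{\nu\log(1+pa/s^2)}}{n}\right\}$. Further $$\mathscr{V}_a:=\left\{2^k: k\in\mathbb{N}\cup\{0\},\ 2^{k-1}<\nu_{\mathcal{H}}(s,a)\le2^k\text{ for some }s\in[p]\right\},\qquad \mathscr{A}_{\mathcal{H}}:=\sup\{a\ge1:\log(e|\mathscr{V}_a|)\ge a\},$$ $$\widetilde{\mathscr{V}}_{\mathcal{H}}:=\left\{2^k: k\in\mathbb{N}\cup\{0\},\ 2^{k-1}<\nu_{\mathcal{H}}(s,\mathscr{A}_{\mathcal{H}})\le2^k\text{ for some }s\in\mathcal{S}\right\}.$$ *)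

(* Defs.v *)
(* MathComp-Analysis over an arbitrary [R : realType]. *)
From HB Require Import structures.
From mathcomp Require Import all_boot all_order all_algebra.
From mathcomp Require Import finmap.
From mathcomp Require Import all_classical all_reals all_analysis.

Set Implicit Arguments.
Unset Strict Implicit.
Unset Printing Implicit Defensive.
Import Order.TTheory GRing.Theory Num.Theory.
Import numFieldNormedType.Exports.
Local Open Scope classical_set_scope.
Local Open Scope ring_scope.

Section product_law.
Context {d} {T : measurableType d} {R : realType}.

Let tcons n (x : T * n.-tuple T) : n.+1.-tuple T := [tuple of x.1 :: x.2].

Let measurable_tcons n : measurable_fun setT (@tcons n).
Proof. exact: measurable_cons. Qed.

HB.instance Definition _ n :=
  isMeasurableFun.Build _ _ _ _ (@tcons n) (@measurable_tcons n).

(* The n-fold product P x ... x P, as a law on n-tuples. *)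
Fixpoint prod_law (P : probability T R) (n : nat)
    : probability (n.-tuple T) R :=
  if n is n'.+1 then distribution (P \x prod_law P n')%E (@tcons n')
  else dirac [tuple].

End product_law.

(* Functions on [0,1] (resp. [0,1]^p) are represented by functions on R (resp.
   on p-tuples of reals); the measures below live on [0,1] (resp. [0,1]^p). *)
Section lebesgue_on_cube.
Variable R : realType.

Definition leb01 : set (measurableTypeR R) -> \bar R :=
  mrestr lebesgue_measure (@measurable_itv R `[0, 1]).

HB.instance Definition _ := Measure.on leb01.

Let leb01_setT : leb01 setT = 1%E.
Proof. by rewrite /leb01 /mrestr setTI lebesgue_measure_itv/= lte01 oppr0 adde0. Qed.

HB.instance Definition _ :=
  Measure_isProbability.Build _ _ _ leb01 leb01_setT.

Definition leb_cube (p : nat) : probability (p.-tuple (measurableTypeR R)) R :=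
  prod_law leb01 p.

Lemma le1_2E : (1 <= 2%:E :> \bar R)%E.
Proof. by rewrite lee_fin ler1n. Qed.

End lebesgue_on_cube.

(* Square-integrable functions on [0,1]^p, as functions (not a.e. classes). *)
Definition L2cube (R : realType) (p : nat) := LfunType (leb_cube R p) (le1_2E R).

Definition dotL2 {d} {T : measurableType d} {R : realType}
    (m : {measure set T -> \bar R}) (f g : T -> R) : R :=
  \int[m]_x (f x * g x).

Definition normL2 {d} {T : measurableType d} {R : realType}
    (m : {measure set T -> \bar R}) (f : T -> R) : \bar R :=
  'N[m]_2%:E[EFin \o f]%E.

Section rkhs.
Variable R : realType.
Implicit Types (H : set (R -> R)) (ip : (R -> R) -> (R -> R) -> R)
  (K : R -> R -> R).

Definition hnorm ip (f : R -> R) : R := Num.sqrt (ip f f).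

(* H, with inner product ip, is a Hilbert space of functions on [0,1],
   contained in L^2([0,1]), with reproducing kernel K.  Functions on [0,1] are
   extended by 0, so that equality on [0,1] is equality of functions. *)
Record is_rkhs H ip K : Prop := {
  rkhs_supp : forall f (x : R), H f -> x \notin `[0, 1] -> f x = 0;
  rkhs_L2 : forall f, H f -> f \in Lfun (@leb01 R) 2%:E;
  rkhs0 : H (cst 0);
  rkhs_lin : forall (a : R) f g, H f -> H g -> H (a *: f + g);
  rkhs_ip_sym : forall f g, H f -> H g -> ip f g = ip g f;
  rkhs_ip_lin : forall (a : R) f g h, H f -> H g -> H h ->
    ip (a *: f + g) h = a * ip f h + ip g h;
  rkhs_ip_ge0 : forall f, H f -> 0 <= ip f f;
  rkhs_ip_eq0 : forall f, H f -> ip f f = 0 -> f = cst 0;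
  rkhs_complete : forall u : nat -> R -> R, (forall i, H (u i)) ->
    (forall e : R, 0 < e -> exists N, forall i j,
       (N <= i)%N -> (N <= j)%N -> hnorm ip (u i - u j) < e) ->
    exists2 f, H f & (hnorm ip (u i - f) @[i --> \oo] --> 0);
  rkhs_kernel : forall x : R, x \in `[0, 1] -> H (K x);
  rkhs_reproducing : forall f (x : R), H f -> x \in `[0, 1] -> ip f (K x) = f x
}.

(* Mercer expansion of K.  Indices start at 1: mu 0 and psi 0 are not used. *)
Record mercer_expansion K (mu : nat -> R) (psi : nat -> R -> R) : Prop := {
  mercer_ge0 : forall k, (0 < k)%N -> 0 <= mu k;
  mercer_noninc : forall k, (0 < k)%N -> mu k.+1 <= mu k;
  mercer_L2 : forall k, (0 < k)%N -> psi k \in Lfun (@leb01 R) 2%:E;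
  mercer_orthonormal : forall k l, (0 < k)%N -> (0 < l)%N ->
    dotL2 (@leb01 R) (psi k) (psi l) = (k == l)%:R;
  mercer_eigen : forall k (x : R), (0 < k)%N -> x \in `[0, 1] ->
    dotL2 (@leb01 R) (K x) (psi k) = mu k * psi k x;
  mercer_series : forall x y : R, x \in `[0, 1] -> y \in `[0, 1] ->
    (\sum_(1 <= k < N) mu k * psi k x * psi k y @[N --> \oo] --> K x y)
}.

Definition orth_cst1 H : set (R -> R) :=
  [set g | H g /\ dotL2 (@leb01 R) g (cst 1) = 0].

(* H0 has the eigenfunctions psi and the eigenvalues mu:
   ||g||^2 = sum_k <g, psi_k>^2 / mu_k.  The division is that of the extended
   reals, where 0 / 0 = 0 and c / 0 = +oo for c > 0: for a zero eigenvalue the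
   identity forces <g, psi_k> = 0. *)
Record spectral_norm (H0 : set (R -> R)) ip (mu : nat -> R)
    (psi : nat -> R -> R) : Prop := {
  spectral_mem : forall k, (0 < k)%N -> 0 < mu k -> H0 (psi k);
  spectral_normE : forall g, H0 g ->
    ((hnorm ip g ^+ 2)%:E =
     \sum_(1 <= k <oo) ((dotL2 (@leb01 R) g (psi k) ^+ 2)%:E / (mu k)%:E))%E
}.

(* Additive functions with components in the unit ball of H0. *)
Definition additive_class (H0 : set (R -> R)) ip (p : nat) (S : {set 'I_p}) :
    set (p.-tuple R -> R) :=
  [set f | exists2 fj : 'I_p -> R -> R,
     forall j, j \in S -> H0 (fj j) /\ hnorm ip (fj j) <= 1 &
     forall x, f x = \sum_(j in S) fj j (tnth x j)].

Definition sparse_class (H0 : set (R -> R)) ip (p s : nat) :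
    set (p.-tuple R -> R) :=
  \bigcup_(S in [set S : {set 'I_p} | (#|S| <= s)%N]) additive_class H0 ip S.

End rkhs.
Arguments sparse_class {R} H0 ip p s _.

Section adaptation.
Variables (R : realType) (mu : nat -> R) (p n : nat).

Definition noise_level (s : nat) (a : R) (nu : nat) : R :=
  Num.sqrt (nu%:R * ln (1 + p%:R * a / s%:R ^+ 2)) / n%:R.

(* The smallest positive nu with mu_nu <= noise_level s a nu. *)
Definition nuH (s : nat) (a : R) : nat :=
  [get nu | [/\ (0 < nu)%N, mu nu <= noise_level s a nu &
    forall k, (0 < k)%N -> mu k <= noise_level s a k -> (nu <= k)%N]].

Definition GammaH (s : nat) (a : R) : R :=
  sup [set Num.min (mu nu) (noise_level s a nu) | nu in [set k | (0 < k)%N]].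

(* {2^k : 2^(k-1) < nuH s a <= 2^k for some s in S}; the first inequality is
   doubled so as to make sense in nat when k = 0. *)
Definition dyadic_scales (a : R) (S : set nat) : set nat :=
  [set (2 ^ k)%N | k in
    [set k | exists2 s, S s & (2 ^ k < 2 * nuH s a)%N && (nuH s a <= 2 ^ k)%N]].

Definition log_card (V : set nat) : R := ln (expR 1 * #|` fset_set V |%:R).

Definition sparsities : set nat := [set s | (1 <= s <= p)%N].

Definition AH : R :=
  sup [set a : R | 1 <= a /\ a <= log_card (dyadic_scales a sparsities)].

Definition large (s : nat) : bool := Num.sqrt (p%:R * AH) <= s%:R.

Definition large_sparsities : set nat := sparsities `&` [set s | large s].

Definition Vtilde : set nat := dyadic_scales AH large_sparsities.

Definition psi_adapt_sq (s : nat) : R :=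
  if s%:R < Num.sqrt (p%:R * AH) then
    Num.max (s%:R / n%:R * ln (1 + p%:R * AH / s%:R ^+ 2))
            (s%:R * GammaH s AH)
  else s%:R * GammaH s AH.

Definition psi_adapt (s : nat) : R := Num.sqrt (psi_adapt_sq s).

End adaptation.

Definition asymp_with {R : realType} (C a b : R) : Prop :=
  C^-1 * b <= a /\ a <= C * b.

Section white_noise.
Context {R : realType} {p : nat}.

(* Centered Gaussian vectors of covariance Sigma are the vectors distributed as
   A z, with z a standard Gaussian vector and A A^T = Sigma. *)
Definition gaussian_law {m k : nat} (A : 'M[R]_(m, k)) :
    set (m.-tuple (measurableTypeR R)) -> \bar R :=
  pushforward (prod_law (normal_prob 0 1) k)
    (fun z => [tuple \sum_j A i j * tnth z j | i < m]).

(* White noise on [0,1]^p, W g standing for the integral of g against dB: a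
   centered Gaussian process with covariance E[W g * W h] = <g, h>. *)
Definition white_noise {d} {Omega : measurableType d}
    (P : probability Omega R)
    (W : L2cube R p -> {RV P >-> measurableTypeR R}) : Prop :=
  forall (m : nat) (g : 'I_m -> L2cube R p),
  exists k (A : 'M[R]_(m, k)),
    (forall i j, (A *m A^T) i j = dotL2 (leb_cube R p) (g i) (g j)) /\
    (forall B, measurable B ->
       P ((fun w => [tuple W (g i) w | i < m]) @^-1` B) = gaussian_law A B).

Definition coordinate_events : set (set (L2cube R p -> R)) :=
  [set E | exists (g : L2cube R p) (B : set (measurableTypeR R)),
     measurable B /\ E = (fun y => y g) @^-1` B].

(* An observation Y is the family of the integrals of g against dY, g in L^2,
   with the sigma-algebra generated by the coordinates. *)
Definition observation := g_sigma_algebraType coordinate_events.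

Definition observe {d} {Omega : measurableType d} {P : probability Omega R}
    (W : L2cube R p -> {RV P >-> measurableTypeR R}) (n : nat)
    (f : p.-tuple R -> R) (w : Omega) : observation :=
  fun g => dotL2 (leb_cube R p) f g + (Num.sqrt n%:R)^-1 * W g w.

Definition law {d} {Omega : measurableType d} {P : probability Omega R}
    (W : L2cube R p -> {RV P >-> measurableTypeR R}) (n : nat)
    (f : p.-tuple R -> R) : set observation -> \bar R :=
  pushforward P (observe W n f).

End white_noise.

(* Main.v *)
Require Import Defs.
From HB Require Import structures.
From mathcomp Require Import all_boot all_order all_algebra.
From mathcomp Require Import finmap.
From mathcomp Require Import all_classical all_reals all_analysis.
From mathcomp Require Import measurable_realfun random_variable normal_distribution.
From mathcomp Require Import ring lra zify.

Set Implicit Arguments.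
Unset Strict Implicit.
Unset Printing Implicit Defensive.
Import Order.TTheory GRing.Theory Num.Theory.
Import numFieldNormedType.Exports.
Local Open Scope classical_set_scope.
Local Open Scope ring_scope.

(** The bound is a second-moment argument.  Put a finitely supported prior [w]
    on signals [f_i] taken from the alternatives.  The sum of the two errors of
    a test with rejection region [B], averaged over the prior, is
    [1 - E_0[1_B (L - 1)]], where [L = sum_i w_i dP_{f_i}/dP_0], and this is at
    least [1 - eta] as soon as [E_0 L^2 <= 1 + eta^2] ([mixture_lower_bound]).
    In white noise the densities are explicit,
    [dP_f/dP_0 = exp (sqrt n W f - n |f|^2 / 2)] ([girsanov]), hence
    [E_0 L^2 = sum_{i,j} w_i w_j exp (n <f_i, f_j>)]
    ([integral_likelihood_ratioM]): only a finite double sum is left to bound.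

    The prior is drawn in three steps.  First a scale [2^k] of [Vtilde],
    uniformly; it comes with a sparsity [s >= sqrt (p A)] and the dimension
    [nu = nuH s A - 1], which is comparable to [2^k].  Then a support [S] of
    size [s], one coordinate in each of [s] disjoint blocks.  Then independent
    signs [r_{jk}], giving the signal
    [sum_{j in S} sum_{k <= nu} rho r_{jk} psi_k(x_j)] with
    [rho^2 = c^2 Gamma(s, A) / nu].  Its squared norm is [c^2 s Gamma], exactly
    the required separation.  By the choice of [nu] and the assumption on [n],
    [Gamma^2 <= 2 mu_nu^2] and [Gamma^2 <= 2 nu (p A / s^2) / n^2]
    ([effective_dimension]): the first bound puts every component in the unit
    ball, the second one controls the second moment.

    For the second moment, freeze one of the two draws, say with support [T] of
    size [s'].  Averaging over the signs of the other draw gives at most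
    [exp (l |S cap T|)] with [l = 2 n^2 rho^2 rho'^2 min(nu, nu')]
    ([random_signs_mgf]); averaging over [S] gives at most
    [exp ((e^l - 1) 2 s s' / p)] ([random_support]).  As
    [min(nu, nu')^2 / (nu nu')] decays geometrically in the distance of the two
    scales, this is at most [exp (32 c^4 A (3/4)^|k - k'|)]
    ([pair_exponent_le]).  The hypothesis [A <= C ln (e |V|)] makes
    [exp (32 c^4 A) <= (e |V|)^(1/2)] for small [c], a loss which the average
    over the [|V|] scales absorbs, because the geometric weights have a bounded
    sum over distinct scales ([scale_average_le]).  The second moment is thus
    [1 + O(c^4)], with a constant depending on [C] only. *)

(** * Integration against a density *)

Section density.
Context d (T : measurableType d) (R : realType).
Variables (mu nu : {measure set T -> \bar R}) (g : T -> R).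
Hypotheses (mg : measurable_fun setT g) (g0 : forall x, 0 <= g x).
Hypothesis nuE :
  forall A, measurable A -> nu A = (\int[mu]_(x in A) (g x)%:E)%E.
Import HBNNSimple.

Let nnsfun_density (f : {nnsfun T >-> R}) :
  (\int[nu]_x (f x)%:E = \int[mu]_x ((f x)%:E * (g x)%:E))%E.
Proof.
under [LHS]eq_integral do rewrite fimfunE -fsumEFin//.
rewrite ge0_integral_fsum//; last 2 first.
- by move=> r; exact/measurable_EFinP/measurable_funM.
- by move=> r x _; rewrite nnfun_muleindic_ge0.
have mfg (r : R) : measurable_fun [set: T]
    (fun x => (r * \1_(f @^-1` [set r]) x)%:E * (g x)%:E)%E.
  by apply: emeasurable_funM; apply/measurable_EFinP => //; exact/measurable_funM.
transitivity (\int[mu]_x (\sum_(r \in range f)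
    ((r * \1_(f @^-1` [set r]) x)%:E * (g x)%:E)))%E; last first.
  apply: eq_integral => x _; rewrite -ge0_mule_fsuml; last first.
    by move=> r; exact: nnfun_muleindic_ge0.
  by congr (_ * _)%E; rewrite fsumEFin// -fimfunE.
rewrite ge0_integral_fsum//; last first.
  by move=> r x _; rewrite mule_ge0// ?nnfun_muleindic_ge0// lee_fin.
apply: eq_fsbigr => r _.
rewrite integralZl_indic_nnsfun// integral_indic// setIT nuE//.
have [r0|r0] := ltP r 0.
  rewrite preimage_nnfun0// integral_set0 mule0 integral0_eq// => x _.
  by rewrite indic0/= mulr0 mul0e.
rewrite (integral_mkcond (f @^-1` [set r])) -ge0_integralZl//; last 2 first.
  apply/(measurable_restrictT _ _).1 => //.
  by apply: measurable_funTS; exact/measurable_EFinP.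
  by move=> x _; rewrite patchE; case: ifP => // _; rewrite lee_fin.
apply: eq_integral => x _; rewrite patchE indicE EFinM -muleA; congr (_ * _)%E.
by case: ifPn => _; rewrite ?mul1e ?mul0e.
Qed.

Lemma ge0_integral_density (f : T -> \bar R) :
  measurable_fun setT f -> (forall x, 0 <= f x)%E ->
  (\int[nu]_x f x = \int[mu]_x (f x * (g x)%:E))%E.
Proof.
move=> mf f0; pose f_ := nnsfun_approx measurableT mf.
transitivity (lim (\int[nu]_x (f_ n x)%:E @[n --> \oo])%E).
  rewrite -monotone_convergence//=.
  - apply: eq_integral => ? /[!inE] xD; apply/esym/cvg_lim => //=.
    exact: cvg_nnsfun_approx.
  - by move=> n; exact/measurable_EFinP/measurable_funTS.
  - by move=> n ? _; rewrite lee_fin.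
  - by move=> ? _ ? ? mn; rewrite lee_fin; exact/lefP/nd_nnsfun_approx.
under eq_fun do rewrite nnsfun_density.
rewrite -monotone_convergence//=.
- apply: eq_integral => x _; apply/cvg_lim => //=.
  by apply: cvgeZr => //; exact: cvg_nnsfun_approx.
- move=> n; apply: emeasurable_funM; last exact/measurable_EFinP.
  by exact/measurable_EFinP/measurable_funTS.
- by move=> n x _; rewrite mule_ge0// lee_fin.
- move=> x _ a b ab; rewrite lee_wpmul2r ?lee_fin//.
  exact/lefP/nd_nnsfun_approx.
Qed.

End density.

(** * Product laws and the Cameron-Martin formula *)

Section prod_law.
Context d (T : measurableType d) (R : realType) (P : probability T R).

Lemma ge0_integral_prod_law n (h : n.+1.-tuple T -> \bar R) :
  measurable_fun setT h -> (forall x, 0 <= h x)%E ->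
  (\int[prod_law P n.+1]_x h x =
   \int[P]_x \int[prod_law P n]_z h [tuple of x :: z])%E.
Proof.
move=> mh h0; rewrite /= ge0_integral_distribution//.
rewrite fubini_tonelli1//; last by move=> x /=.
by apply: measurableT_comp => //=; exact: measurable_cons.
Qed.

Lemma prod_law_box n (A : 'I_n -> set T) : (forall i, measurable (A i)) ->
  prod_law P n [set x | forall i, A i (tnth x i)] =
  (\prod_(i < n) P (A i))%E.
Proof.
elim: n A => [|n IH] A mA.
  rewrite big_ord0 /= diracE (_ : _ \in _)// inE/=.
  by case.
rewrite big_ord_recl -IH//.
rewrite -product_measure1E//; last first.
  rewrite (_ : mkset _ =
    \bigcap_(i in [set: 'I_n]) (fun x => tnth x i) @^-1` (A (lift ord0 i))).
    apply: fin_bigcap_measurable => // i _.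
    by rewrite -[X in measurable X]setTI; exact: measurable_tnth.
  by apply/seteqP; split => [x /= xA i _|x xA i]; apply: xA.
rewrite /= /distribution /pushforward; congr (product_measure1 _ _ _).
apply/seteqP; split => [[x z]/= xA|[x z] /= [xA zA] i].
  split; first by have := xA ord0.
  by move=> i; have := xA (lift ord0 i); rewrite tnthS.
by case: (unliftP ord0 i) => [j ->|-> //]; rewrite tnthS.
Qed.

End prod_law.

Section normal_shift.
Variable R : realType.
Local Notation mu := lebesgue_measure.
Local Notation N01 := (normal_prob (0 : R) 1).

Lemma lebesgue_measure_shift (a : R) (A : set R) : measurable A ->
  pushforward mu ((fun x => x + a) : _ -> measurableTypeR R) A = mu A.
Proof.
move=> mA; apply/esym/lebesgue_measure_unique => //=.
- exact: measurable_funD.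
- move=> ? _ [[x y]] _ <-.
  rewrite /pushforward.
  rewrite (_ : _ @^-1` _ = `]x - a, y - a]%classic); last first.
    apply/seteqP; split=> z/=; rewrite !in_itv/=; lra.
  rewrite !lebesgue_measure_itv/= !lte_fin ltrD2r; case: ifP => // _.
  by rewrite -!EFinB; congr _%:E; ring.
Qed.

Lemma ge0_integral_shift (a : R) (f : R -> \bar R) :
  measurable_fun setT f -> (forall x, 0 <= f x)%E ->
  (\int[mu]_x f (x + a)%R = \int[mu]_x f x)%E.
Proof.
move=> mf f0.
have ms : measurable_fun [set: measurableTypeR R]
    ((fun x => x + a) : _ -> measurableTypeR R).
  exact: measurable_funD.
rewrite -[LHS](ge0_integral_pushforward ms _ measurableT)//.
by apply: eq_measure_integral => //= A mA _; exact: lebesgue_measure_shift.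
Qed.

Lemma ge0_integral_normal_prob (m s : R) (f : R -> \bar R) :
  measurable_fun setT f -> (forall x, 0 <= f x)%E ->
  (\int[normal_prob m s]_x f x = \int[mu]_x (f x * (normal_pdf m s x)%:E))%E.
Proof.
move=> mf f0; apply: ge0_integral_density => //.
- exact: measurable_normal_pdf.
- exact: normal_pdf_ge0.
Qed.

Lemma normal_pdf_shift (a x : R) :
  expR (a * x - a ^+ 2 / 2) * normal_pdf 0 1 x = normal_pdf 0 1 (x - a).
Proof.
rewrite !normal_pdfE ?oner_neq0// mulrCA; congr (_ * _).
rewrite /normal_fun -expRD; congr expR.
by rewrite !subr0 expr1n; field.
Qed.

(** Completing the square: the weight times the standard density is the
    density shifted by [a], and the Lebesgue measure is translation invariant. *)
Lemma cameron_martin_normal (a : R) (h : R -> \bar R) :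
  measurable_fun setT h -> (forall x, 0 <= h x)%E ->
  (\int[N01]_x (h x * (expR (a * x - a ^+ 2 / 2))%:E) =
   \int[N01]_x h (x + a)%R)%E.
Proof.
move=> mh h0.
have me : measurable_fun [set: R] (fun x : R => expR (a * x - a ^+ 2 / 2)).
  apply: measurableT_comp => //; apply: measurable_funB => //.
have mha : measurable_fun [set: R] (fun x : R => h (x + a)).
  by apply: measurableT_comp => //; exact: measurable_funD.
rewrite !ge0_integral_normal_prob//; last 2 first.
- by apply: emeasurable_funM => //; exact/measurable_EFinP.
- by move=> x; rewrite mule_ge0// lee_fin expR_ge0.
under eq_integral do rewrite -muleA -EFinM normal_pdf_shift.
rewrite -[LHS](ge0_integral_shift a); last 2 first.
- apply: emeasurable_funM => //; apply/measurable_EFinP.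
  apply: (measurableT_comp (measurable_normal_pdf 0 1)).
  exact: measurable_funB.
- by move=> x; rewrite mule_ge0// lee_fin normal_pdf_ge0.
by under eq_integral do rewrite addrK.
Qed.

End normal_shift.

Section cameron_martin.
Variable R : realType.
Local Notation gauss := (prod_law (normal_prob (0 : R) 1)).

Definition shift_tuple k (a : 'I_k -> R) (z : k.-tuple R) : k.-tuple R :=
  [tuple tnth z i + a i | i < k].

Lemma measurable_shift_tuple k (a : 'I_k -> R) :
  measurable_fun [set: k.-tuple (measurableTypeR R)]
    (shift_tuple a : _ -> k.-tuple (measurableTypeR R)).
Proof.
apply/measurable_fun_tnthP => i /=.
rewrite (_ : _ \o _ = fun z : k.-tuple (measurableTypeR R) => tnth z i + a i).
  by apply: measurable_funD => //; exact: measurable_tnth.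
by apply/funext => z /=; rewrite tnth_mktuple.
Qed.

Lemma measurable_linear_form k (a : 'I_k -> R) :
  measurable_fun [set: k.-tuple (measurableTypeR R)]
    (fun z => \sum_i a i * tnth z i).
Proof.
apply: measurable_sum => i.
by apply: measurable_funM => //; exact: measurable_tnth.
Qed.

(** By induction on the dimension: integrating out all coordinates but the first
    one shifts them, and the one-dimensional formula shifts the last one left. *)
Lemma cameron_martin k (a : 'I_k -> R)
    (h : k.-tuple (measurableTypeR R) -> \bar R) :
  measurable_fun setT h -> (forall z, 0 <= h z)%E ->
  (\int[gauss k]_z
      (h z * (expR (\sum_i a i * tnth z i - (\sum_i a i ^+ 2) / 2))%:E) =
   \int[gauss k]_z h (shift_tuple a z))%E.
Proof.
elim: k a h => [|k IH] a h mh h0.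
  apply: eq_integral => z _; rewrite !big_ord0 mul0r subr0 expR0 mule1.
  by congr h; apply: eq_from_tnth => -[].
have me : measurable_fun [set: (k.+1).-tuple (measurableTypeR R)]
    (fun z => expR (\sum_i a i * tnth z i - (\sum_i a i ^+ 2) / 2)).
  apply: measurableT_comp => //; apply: measurable_funB => //.
  exact: measurable_linear_form.
rewrite !ge0_integral_prod_law//; last first.
- by move=> z; rewrite mule_ge0// lee_fin expR_ge0.
- by apply: emeasurable_funM => //; exact/measurable_EFinP.
- exact: (measurableT_comp mh (measurable_shift_tuple a)).
pose a' i := a (lift ord0 i).
pose H x := (\int[gauss k]_z h [tuple of x :: shift_tuple a' z])%E.
have mH : measurable_fun [set: measurableTypeR R] H.
  pose h2 (xz : measurableTypeR R * k.-tuple (measurableTypeR R)) :=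
    h [tuple of xz.1 :: shift_tuple a' xz.2].
  apply: (measurable_fun_fubini_tonelli_F h2); last by move=> x; exact: h0.
  apply: (measurableT_comp mh); apply: measurable_cons => //.
  by apply: (measurableT_comp (measurable_shift_tuple a')).
transitivity (\int[normal_prob 0 1]_x
    (H x * (expR (a ord0 * x - a ord0 ^+ 2 / 2))%:E))%E.
  apply: eq_integral => x _.
  have mhx : measurable_fun setT (fun z : k.-tuple (measurableTypeR R) =>
      h [tuple of x :: z]).
    by apply: (measurableT_comp mh); exact: measurable_cons.
  rewrite /H -(IH a' (fun z => h [tuple of x :: z]))//.
  rewrite -ge0_integralZr//; last 2 first.
  - apply: emeasurable_funM => //; apply/measurable_EFinP.
    apply: measurableT_comp => //; apply: measurable_funB => //.
    exact: measurable_linear_form.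
  - by move=> z _; rewrite mule_ge0// lee_fin expR_ge0.
  apply: eq_integral => z _; rewrite -muleA -EFinM -expRD !big_ord_recl/=.
  congr (_ * (expR _)%:E)%E; rewrite /a'.
  under eq_bigr do rewrite tnthS.
  by rewrite mulrDl opprD addrACA addrC.
rewrite cameron_martin_normal//; last by move=> x; exact: integral_ge0.
apply: eq_integral => x _; apply: eq_integral => z _; congr h.
apply: eq_from_tnth => i; rewrite tnth_mktuple.
by case: (unliftP ord0 i) => [j ->|->//]; rewrite !tnthS tnth_mktuple.
Qed.

End cameron_martin.

(** * Gaussian white noise and its likelihood ratios *)

Section integral_measure.
Context d (T : measurableType d) (R : realType).
Variables (mu : {measure set T -> \bar R}) (g : T -> R).
Hypotheses (mg : measurable_fun setT g) (g0 : forall x, 0 <= g x).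

Definition weighted_measure (A : set T) : \bar R :=
  (\int[mu]_(x in A) (g x)%:E)%E.

Let weighted_measure0 : weighted_measure set0 = 0%E.
Proof. by rewrite /weighted_measure integral_set0. Qed.

Let weighted_measure_ge0 A : (0 <= weighted_measure A)%E.
Proof. by apply: integral_ge0 => x _; rewrite lee_fin. Qed.

Let weighted_measure_sigma_additive : semi_sigma_additive weighted_measure.
Proof.
move=> F mF tF mUF; rewrite /weighted_measure; apply: cvg_toP.
  apply: ereal_nondecreasing_is_cvgn => m n mn.
  apply: lee_sum_nneg_natr => // k _ _.
  by apply: integral_ge0 => /= x _; rewrite lee_fin.
rewrite ge0_integral_bigcup//=.
- by apply: measurable_funTS; exact/measurable_EFinP.
- by move=> x _; rewrite lee_fin.
Qed.

HB.instance Definition _ := isMeasure.Build _ _ _ weighted_measure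
  weighted_measure0 weighted_measure_ge0 weighted_measure_sigma_additive.

(** The measure structure of [weighted_measure] depends on proofs that [g] is
    measurable and nonnegative; packing it makes it usable as an argument. *)
Lemma weighted_measureE :
  exists m : {measure set T -> \bar R}, m = weighted_measure :> (set T -> \bar R).
Proof. by exists [the measure _ _ of weighted_measure]. Qed.

End integral_measure.

Lemma pushforward_measureE d1 d2 (T1 : measurableType d1)
    (T2 : measurableType d2) (R : realType) (m : {measure set T1 -> \bar R})
    (f : T1 -> T2) : measurable_fun setT f ->
  exists m' : {measure set T2 -> \bar R},
    m' = pushforward m f :> (set T2 -> \bar R).
Proof. by move=> mf; unshelve eexists [the measure _ _ of pushforward m f]. Qed.


Section gaussian_vectors.
Context {R : realType} {p : nat}.
Context {d} {Omega : measurableType d} {P : probability Omega R}.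
Variable W : L2cube R p -> {RV P >-> measurableTypeR R}.
Hypothesis W_noise : white_noise W.
Local Notation gauss := (prod_law (normal_prob (0 : R) 1)).
Local Notation dot := (dotL2 (leb_cube R p)).

Lemma measurable_mktuple d' (T : measurableType d') m
    (F : 'I_m -> T -> measurableTypeR R) :
  (forall i, measurable_fun setT (F i)) ->
  measurable_fun setT
    ((fun w => [tuple F i w | i < m]) : T -> m.-tuple (measurableTypeR R)).
Proof.
move=> mF; apply/measurable_fun_tnthP => i /=.
rewrite (_ : _ \o _ = F i)//.
by apply/funext => w /=; rewrite tnth_mktuple.
Qed.

(** A finite family of coordinates of the noise is an image [A z] of a standard
    Gaussian vector, so integrals over [Omega] become finite-dimensional. *)
Lemma ge0_integral_white_noise m (g : 'I_m -> L2cube R p) :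
  exists k (A : 'M[R]_(m, k)),
    (forall i j, \sum_l A i l * A j l = dot (g i) (g j)) /\
    forall F : m.-tuple (measurableTypeR R) -> \bar R,
      measurable_fun setT F -> (forall y, 0 <= F y)%E ->
      (\int[P]_w F [tuple W (g i) w | i < m] =
       \int[gauss k]_z F [tuple (\sum_j A i j * tnth z j)%R | i < m])%E.
Proof.
have [k [A [AA lawA]]] := W_noise g.
exists k, A; split=> [i j|F mF F0].
  by rewrite -AA mxE; apply: eq_bigr => l _; rewrite mxE.
have mW : measurable_fun setT ((fun w => [tuple W (g i) w | i < m]) :
    Omega -> m.-tuple (measurableTypeR R)).
  by apply: measurable_mktuple => i; exact: measurable_funP.
have mA : measurable_fun setT
    ((fun z => [tuple \sum_j A i j * tnth z j | i < m]) :
     k.-tuple (measurableTypeR R) -> m.-tuple (measurableTypeR R)).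
  by apply: measurable_mktuple => i; exact: measurable_linear_form.
rewrite -[LHS](ge0_integral_pushforward mW _ measurableT)//.
rewrite -[RHS](ge0_integral_pushforward mA _ measurableT)//.
by apply: eq_measure_integral => B mB _; exact: lawA.
Qed.

(** The density of the law of the observation under the signal [f] with respect
    to pure noise, as a function on [Omega]; see [girsanov]. *)
Definition likelihood_ratio (n : nat) (f : L2cube R p) (w : Omega) : R :=
  expR (Num.sqrt n%:R * W f w - n%:R * dot f f / 2).

Lemma likelihood_ratio_ge0 n f w : 0 <= likelihood_ratio n f w.
Proof. exact: expR_ge0. Qed.

Lemma measurable_likelihood_ratio n f :
  measurable_fun setT (likelihood_ratio n f).
Proof.
apply: measurableT_comp => //; apply: measurable_funB => //.
apply: measurable_funM => //; exact: (measurable_funP (W f)).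
Qed.

(** The joint law of [W f] and the [W (g i)] is that of [A z].  Weighting by the
    likelihood ratio shifts [z] by [sqrt n] times the row of [f] in [A], hence
    [A z] by [sqrt n <f, g i>], which is the drift created by the signal. *)
Lemma girsanov_box n (f : L2cube R p) m (g : 'I_m -> L2cube R p)
    (B : 'I_m -> set (measurableTypeR R)) : (0 < n)%N ->
  (forall i, measurable (B i)) ->
  P [set w | forall i, B i (observe W n f w (g i))] =
  (\int[P]_(w in [set w | forall i, B i (observe W n (cst 0%R) w (g i))])
     (likelihood_ratio n f w)%:E)%E.
Proof.
move=> n0 mB; pose s : R := Num.sqrt n%:R.
have s0 : s != 0 by rewrite gt_eqF// sqrtr_gt0 ltr0n.
have ss : s * s = n%:R by rewrite -expr2 sqr_sqrtr.
(* The function f itself is adjoined as coordinate 0. *)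
pose gg (i : 'I_m.+1) := if unlift ord0 i is Some j then g j else f.
have gg0 : gg ord0 = f by rewrite /gg unlift_none.
have ggS j : gg (lift ord0 j) = g j by rewrite /gg liftK.
have [k [A [AA EA]]] := ge0_integral_white_noise gg.
have dot0 (h : L2cube R p) : dot (cst 0) h = 0.
  rewrite /dotL2; under eq_Rintegral do rewrite mul0r.
  by rewrite Rintegral_cst//= mul0r.
pose D (u : 'I_m -> R) := [set y : m.+1.-tuple (measurableTypeR R) |
  forall i, B i (u i + s^-1 * tnth y (lift ord0 i))].
have mD u : measurable (D u).
  rewrite (_ : D u = \bigcap_(i in [set: 'I_m])
      (fun y => u i + s^-1 * tnth y (lift ord0 i)) @^-1` (B i)); last first.
    by apply/seteqP; split => [y Dy i _|y Dy i]; apply: Dy.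
  apply: fin_bigcap_measurable => // i _.
  rewrite -[X in measurable X]setTI.
  have mu_ : measurable_fun setT ((fun y => u i + s^-1 * tnth y (lift ord0 i)) :
      m.+1.-tuple (measurableTypeR R) -> measurableTypeR R).
    apply: measurable_funD => //; apply: measurable_funM => //.
    exact: measurable_tnth.
  exact: mu_.
pose T w := [tuple W (gg i) w | i < m.+1].
have DE (u : 'I_m -> R) w : D u (T w) <-> forall i, B i (u i + s^-1 * W (g i) w).
  by split=> Dw i; have := Dw i; rewrite tnth_mktuple ggS.
have mT : measurable_fun setT (T : Omega -> m.+1.-tuple (measurableTypeR R)).
  by apply: measurable_mktuple => i; exact: measurable_funP.
have mTD u : measurable [set w | D u (T w)].
  by rewrite -[X in measurable X]setTI; exact: mT.
have -> : [set w | forall i, B i (observe W n f w (g i))] =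
    [set w | D (fun i => dot f (g i)) (T w)].
  by apply/seteqP; split=> w /DE.
have -> : [set w | forall i, B i (observe W n (cst 0%R) w (g i))] =
    [set w | D (fun=> 0) (T w)].
  have obs0 w h : observe W n (cst 0) w h = 0 + s^-1 * W h w.
    by rewrite /observe dot0.
  apply/seteqP; split=> w /= H; last by move: H => /DE H i; rewrite obs0.
  by apply/DE => i; rewrite -obs0.
rewrite -[in LHS](setIT [set w | _]) -integral_indic//.
rewrite [RHS]integral_mkcond.
pose F1 (y : m.+1.-tuple (measurableTypeR R)) : \bar R :=
  (\1_(D (fun i => dot f (g i))) y)%:E.
pose F2 (y : m.+1.-tuple (measurableTypeR R)) : \bar R :=
  ((\1_(D (fun=> 0)) y)%:E * (expR (s * tnth y ord0 - n%:R * dot f f / 2))%:E)%E.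
transitivity (\int[P]_w F1 (T w))%E.
  by apply: eq_integral => w _; rewrite /F1 !indicE.
transitivity (\int[P]_w F2 (T w))%E; last first.
  apply: eq_integral => w _; rewrite patchE /F2 indicE.
  rewrite /likelihood_ratio tnth_mktuple gg0.
  have -> : (T w \in D (fun=> 0)) = (w \in [set w | D (fun=> 0) (T w)]) by [].
  by case: ifPn => _; rewrite ?mul1e ?mul0e.
have mE : measurable_fun setT
    (fun y : m.+1.-tuple (measurableTypeR R) =>
      expR (s * tnth y ord0 - n%:R * dot f f / 2)).
  apply: measurableT_comp => //; apply: measurable_funB => //.
  by apply: measurable_funM => //; exact: measurable_tnth.
have mF2 : measurable_fun setT F2.
  by apply: emeasurable_funM; apply/measurable_EFinP.
have F20 y : (0 <= F2 y)%E by rewrite mule_ge0 ?lee_fin ?expR_ge0.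
have mF1 : measurable_fun setT F1 by exact/measurable_EFinP.
rewrite (EA F1) ?(EA F2)//; last by move=> y; rewrite lee_fin.
pose a j := s * A ord0 j.
pose L (z : k.-tuple R) := [tuple \sum_j A i j * tnth z j | i < m.+1].
have mL : measurable_fun setT
    (L : k.-tuple (measurableTypeR R) -> m.+1.-tuple (measurableTypeR R)).
  by apply: measurable_mktuple => i; exact: measurable_linear_form.
have mh : measurable_fun setT (fun z : k.-tuple (measurableTypeR R) =>
    (\1_(D (fun=> 0)) (L z))%:E : \bar R).
  apply/measurable_EFinP.
  exact: (measurableT_comp (measurable_indic (mD (fun=> 0))) mL).
have h0 (z : k.-tuple (measurableTypeR R)) :
  (0 <= (\1_(D (fun=> 0)) (L z))%:E :> \bar R)%E by rewrite lee_fin.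
have CM := cameron_martin a mh h0.
apply: esym; apply: etrans; first apply: etrans CM.
  apply: eq_integral => z _; rewrite /F2 tnth_mktuple; congr (_ * (expR _)%:E)%E.
  congr (_ - _ / 2).
    by rewrite mulr_sumr; apply: eq_bigr => j _; rewrite mulrA.
  rewrite -gg0 -AA -ss mulr_sumr; apply: eq_bigr => j _.
  by rewrite /a expr2; ring.
apply: eq_integral => z _; rewrite /F1 !indicE; congr (_%:R%:E).
congr nat_of_bool; apply/asbool_equiv_eq.
have shiftE i : s^-1 * tnth (L (shift_tuple a z)) (lift ord0 i) =
    dot f (g i) + s^-1 * tnth (L z) (lift ord0 i).
  rewrite !tnth_mktuple -ggS -gg0 -AA.
  under eq_bigr do rewrite tnth_mktuple mulrDr.
  rewrite big_split mulrDr addrC; congr (_ + _).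
  rewrite mulr_sumr; apply: eq_bigr => j _.
  by rewrite /a; field.
by split=> Dz i; have := Dz i; rewrite add0r shiftE.
Qed.

End gaussian_vectors.

Section likelihood.
Context {R : realType} {p : nat}.
Context {d} {Omega : measurableType d} {P : probability Omega R}.
Variable W : L2cube R p -> {RV P >-> measurableTypeR R}.
Hypothesis W_noise : white_noise W.
Local Notation gauss := (prod_law (normal_prob (0 : R) 1)).
Local Notation dot := (dotL2 (leb_cube R p)).

Lemma measurable_observe n f :
  measurable_fun setT (observe W n f : Omega -> @observation R p).
Proof.
apply: (@measurability _ _ _ (@observation R p) _ _ (@coordinate_events R p)) => //.
move=> _ [_ [g [B [mB ->]]] <-]; rewrite setTI.
have mY : measurable_fun setT ((fun w => observe W n f w g) :
    Omega -> measurableTypeR R).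
  apply: measurable_funD => //; apply: measurable_funM => //.
  exact: (measurable_funP (W g)).
by have := mY measurableT B mB; rewrite setTI.
Qed.

(** A class of sets stable under intersection which generates the sigma-algebra
    of the observation: two finite measures equal on it are equal. *)
Definition boxes : set (set (@observation R p)) :=
  [set E | exists m (g : 'I_m -> L2cube R p)
     (B : 'I_m -> set (measurableTypeR R)),
     (forall i, measurable (B i)) /\ E = [set y | forall i, B i (y (g i))]].

Lemma boxesI : setI_closed boxes.
Proof.
move=> _ _ [m1 [g1 [B1 [mB1 ->]]]] [m2 [g2 [B2 [mB2 ->]]]].
exists (m1 + m2)%N.
exists (fun i : 'I_(m1 + m2) =>
  match fintype.split i with inl j => g1 j | inr j => g2 j end).
exists (fun i : 'I_(m1 + m2) =>
  match fintype.split i with inl j => B1 j | inr j => B2 j end).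
split=> [i|]; first by case: fintype.split.
apply/seteqP; split=> [y [y1 y2] i /=|y /= yB].
  by case: fintype.split => j; [exact: y1|exact: y2].
split=> j /=.
- by have := yB (lshift m2 j); rewrite (unsplitK (inl j)).
- by have := yB (rshift m1 j); rewrite (unsplitK (inr j)).
Qed.

Lemma boxes_measurable : boxes `<=` measurable.
Proof.
move=> _ [m [g [B [mB ->]]]].
rewrite (_ : mkset _ = \bigcap_(i in [set: 'I_m]) [set y | B i (y (g i))]).
  apply: fin_bigcap_measurable => // i _; apply: sub_sigma_algebra.
  by exists (g i), (B i).
by apply/seteqP; split => [y yB i _|y yB i]; apply: yB.
Qed.

(** Both sides are finite measures in [E], and they agree on [boxes]. *)
Lemma girsanov n (f : L2cube R p) (E : set (@observation R p)) :
  (0 < n)%N -> measurable E ->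
  law W n f E =
  (\int[P]_(w in observe W n (cst 0%R) @^-1` E) (likelihood_ratio W n f w)%:E)%E.
Proof.
move=> n0 mE.
have mo g : measurable_fun setT (observe W n g : Omega -> @observation R p).
  exact: measurable_observe.
have [LP LPE] := weighted_measureE P
  (measurable_likelihood_ratio W n f) (likelihood_ratio_ge0 W n f).
have [m1 m1E] := pushforward_measureE P (mo f).
have [m2 m2E] := pushforward_measureE LP (mo (cst 0)).
suff -> : law W n f E = m2 E by rewrite m2E /pushforward LPE.
rewrite /law -m1E; apply: (@g_sigma_algebra_measure_unique _ _ _ boxes
  boxes_measurable (fun=> setT)).
- move=> _; exists 0%N, (fun i => f), (fun=> setT).
  by split=> //; apply/seteqP; split.
- by rewrite bigcup_const.
- exact: boxesI.
- move=> _ [m [g [B [mB ->]]]].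
  rewrite m1E m2E /pushforward LPE.
  exact: girsanov_box.
- by move=> _; rewrite m1E /= /pushforward preimage_setT probability_setT ltry.
- apply: sub_sigma_algebra2 mE => _ [g [B [mB ->]]].
  exists 1%N, (fun=> g), (fun=> B); split=> //.
  by apply/seteqP; split=> [y yB _|y /(_ ord0)].
Qed.

Lemma law_setT n (f : L2cube R p) : law W n f setT = 1%E.
Proof. by rewrite /law /pushforward preimage_setT probability_setT. Qed.

Lemma integral_likelihood_ratio n (f : L2cube R p) : (0 < n)%N ->
  (\int[P]_w (likelihood_ratio W n f w)%:E = 1)%E.
Proof.
by move=> n0; rewrite -(law_setT n f) girsanov// preimage_setT.
Qed.

(** The product of the two ratios is [exp (n <f, g>)] times the Cameron-Martin
    weight of the sum of the two shifts, which integrates to 1. *)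
Lemma integral_likelihood_ratioM n (f g : L2cube R p) :
  (\int[P]_w (likelihood_ratio W n f w * likelihood_ratio W n g w)%:E =
   (expR (n%:R * dot f g))%:E)%E.
Proof.
pose fg (i : 'I_2) := if i == ord0 then f else g.
have [k [A [AA EA]]] := ge0_integral_white_noise W_noise fg.
pose s : R := Num.sqrt n%:R.
have ss : s * s = n%:R by rewrite -expr2 sqr_sqrtr.
pose F (y : 2.-tuple (measurableTypeR R)) : R :=
  expR (s * tnth y ord0 - n%:R * dot f f / 2) *
  expR (s * tnth y (lift ord0 ord0) - n%:R * dot g g / 2).
have mexp i c : measurable_fun setT (fun y : 2.-tuple (measurableTypeR R) =>
    expR (s * tnth y i - c)).
  apply: measurableT_comp => //; apply: measurable_funB => //.
  by apply: measurable_funM => //; exact: measurable_tnth.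
have mF : measurable_fun setT (EFin \o F).
  by apply/measurable_EFinP; apply: measurable_funM.
transitivity (\int[P]_w (EFin \o F) [tuple W (fg i) w | i < 2])%E.
  by apply: eq_integral => w _; rewrite /F /= !tnth_mktuple.
rewrite EA//; last by move=> y; rewrite lee_fin mulr_ge0 ?expR_ge0.
pose a j := s * (A ord0 j + A (lift ord0 ord0) j).
have := @cameron_martin R k a (cst (expR (n%:R * dot f g))%:E) (measurable_cst _).
rewrite integral_cst//= probability_setT mule1 => <-; last first.
  by move=> _; rewrite lee_fin expR_ge0.
apply: eq_integral => z _; rewrite /F /= !tnth_mktuple -EFinM -!expRD.
congr (expR _)%:E.
have ff : dot f f = \sum_j A ord0 j * A ord0 j by rewrite AA.
have gg : dot g g = \sum_j A (lift ord0 ord0) j * A (lift ord0 ord0) j.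
  by rewrite AA.
have fgE : dot f g = \sum_j A ord0 j * A (lift ord0 ord0) j by rewrite AA.
have aE : \sum_j a j ^+ 2 = n%:R * (dot f f + dot g g + 2 * dot f g).
  rewrite ff gg fgE -ss mulrDr !mulrDr !mulr_sumr -!big_split/=.
  by apply: eq_bigr => j _; rewrite /a; ring.
have alE : \sum_j a j * tnth z j = s * (\sum_j A ord0 j * tnth z j) +
    s * (\sum_j A (lift ord0 ord0) j * tnth z j).
  rewrite !mulr_sumr -big_split/=.
  by apply: eq_bigr => j _; rewrite /a; ring.
by rewrite aE alE; field.
Qed.

End likelihood.

(** * Second-moment lower bound for mixtures *)

Lemma convex_combination_le (R : realType) (I : finType) (w x : I -> R)
    (M : \bar R) : (forall i, 0 <= w i) -> \sum_i w i = 1 ->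
  (forall i, 0 < w i -> ((x i)%:E <= M)%E) -> ((\sum_i w i * x i)%:E <= M)%E.
Proof.
move=> w0 w1 xM.
have [i wi] : exists i, 0 < w i.
  apply/not_existsP => wn; have := oner_neq0 R; rewrite -w1 big1 ?eqxx// => i _.
  by apply/le_anti; rewrite w0 andbT leNgt; apply/negP => /wn.
case: M xM => [m| |] xM; last 2 first.
- by rewrite leey.
- by have := xM i wi.
rewrite lee_fin -[m]mul1r -w1 mulr_suml; apply: ler_sum => j _.
have := w0 j; rewrite le_eqVlt => /predU1P[<-|wj]; first by rewrite !mul0r.
by rewrite ler_wpM2l// -lee_fin xM.
Qed.

Section mixture.
Context {R : realType} {p : nat}.
Context {d} {Omega : measurableType d} {P : probability Omega R}.
Variable W : L2cube R p -> {RV P >-> measurableTypeR R}.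
Hypothesis W_noise : white_noise W.
Local Notation dot := (dotL2 (leb_cube R p)).
Variables (n : nat) (n0 : (0 < n)%N).
Variables (I : finType) (w : I -> R) (f : I -> L2cube R p).
Hypotheses (w0 : forall i, 0 <= w i) (w1 : \sum_i w i = 1).
Local Notation LR i := (likelihood_ratio W n (f i)).

Let L (x : Omega) : R := \sum_i w i * LR i x.

Let L0 x : 0 <= L x.
Proof. by apply: sumr_ge0 => i _; rewrite mulr_ge0// likelihood_ratio_ge0. Qed.

Let mL : measurable_fun setT L.
Proof.
apply: measurable_sum => i; apply: measurable_funM => //.
exact: measurable_likelihood_ratio.
Qed.

Let integral_L A : measurable A ->
  (\int[P]_(x in A) (L x)%:E =
   \sum_i (w i)%:E * \int[P]_(x in A) (LR i x)%:E)%E.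
Proof.
move=> mA; under eq_integral do rewrite -sumEFin.
rewrite ge0_integral_sum//; last 2 first.
- move=> i; apply/measurable_EFinP; apply: measurable_funM => //.
  by apply: measurable_funTS; exact: measurable_likelihood_ratio.
- by move=> i x _; rewrite lee_fin mulr_ge0// likelihood_ratio_ge0.
apply: eq_bigr => i _; under eq_integral do rewrite EFinM.
rewrite ge0_integralZl_EFin//.
- by move=> x _; rewrite lee_fin likelihood_ratio_ge0.
- by apply/measurable_EFinP; apply: measurable_funTS;
    exact: measurable_likelihood_ratio.
Qed.

Let integral_L2 : (\int[P]_x (L x ^+ 2)%:E =
  (\sum_i \sum_j w i * w j * expR (n%:R * dot (f i) (f j)))%:E)%E.
Proof.
transitivity (\int[P]_x \sum_i \sum_j
    ((w i * w j)%:E * (LR i x * LR j x)%:E))%E.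
  apply: eq_integral => x _; rewrite expr2 /L mulr_suml -sumEFin.
  apply: eq_bigr => i _; rewrite mulr_sumr -sumEFin.
  by apply: eq_bigr => j _; rewrite -EFinM mulrACA.
have mLR i j : measurable_fun setT
    (fun x => (w i * w j)%:E * (LR i x * LR j x)%:E)%E.
  apply: emeasurable_funM => //; apply/measurable_EFinP.
  by apply: measurable_funM; exact: measurable_likelihood_ratio.
have LR0 i j x : (0 <= (w i * w j)%:E * (LR i x * LR j x)%:E)%E.
  by rewrite mule_ge0// lee_fin mulr_ge0// likelihood_ratio_ge0.
rewrite ge0_integral_sum//; last 2 first.
- by move=> i; apply: emeasurable_sum => j.
- by move=> i x _; apply: sume_ge0.
rewrite -sumEFin; apply: eq_bigr => i _; rewrite ge0_integral_sum//.
rewrite -sumEFin; apply: eq_bigr => j _.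
rewrite ge0_integralZl_EFin//; last 3 first.
- by move=> x _; rewrite lee_fin mulr_ge0// likelihood_ratio_ge0.
- apply/measurable_EFinP.
  by apply: measurable_funM; exact: measurable_likelihood_ratio.
- by rewrite mulr_ge0.
by rewrite integral_likelihood_ratioM// EFinM.
Qed.

(** With [L] the likelihood ratio of the mixture and [B] the rejection region,
    [1_B L + L / eta <= 1_B + eta / 2 + (L^2 + 1) / (2 eta)] pointwise.  Since
    [E_0 L = 1] and [E_0 L^2 <= 1 + eta^2], integrating bounds the power of the
    test against the mixture by its level plus [eta].  This form of the
    inequality has only nonnegative terms, so no integrability is at stake. *)
Lemma mixture_lower_bound (eta : R) (phi : {mfun @observation R p >-> bool})
    (M : \bar R) : 0 < eta ->
  \sum_i \sum_j w i * w j * expR (n%:R * dot (f i) (f j)) <= 1 + eta ^+ 2 ->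
  (forall i, 0 < w i -> (law W n (f i) [set y | phi y <> true] <= M)%E) ->
  ((1 - eta)%:E <= law W n (cst 0%R) [set y | phi y <> false] + M)%E.
Proof.
move=> eta0 chi2 lawM.
pose B := [set y | phi y = true].
have mB : measurable B.
  have mphi : measurable_fun setT phi by exact: measurable_funP.
  by rewrite -[B]setTI; exact: (mphi measurableT [set true]).
have -> : [set y | phi y <> false] = B.
  by apply/seteqP; split=> y; rewrite /B/=; case: (phi y).
have nB : [set y | phi y <> true] = ~` B by apply/seteqP; split.
pose B' := observe W n (cst 0) @^-1` B.
have mo g : measurable_fun setT (observe W n g : Omega -> @observation R p).
  exact: measurable_observe.
have mpre g E : measurable E -> measurable (observe W n g @^-1` E).
  by move=> mE; rewrite -[X in measurable X]setTI; exact: mo.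
have mB' : measurable B' by exact: mpre.
have lawC i : law W n (f i) (~` B) = (1 - law W n (f i) B)%E.
  rewrite /law /pushforward -preimage_setC probability_setC//; exact: mpre.
have lawfin g : law W n g B \is a fin_num.
  by apply: fin_num_measure; exact: mpre.
pose q i := fine (law W n (f i) B).
have qE i : law W n (f i) B = (q i)%:E by rewrite fineK.
pose P0 := fine (law W n (cst 0) B).
have P0E : (P0%:E = P B')%E by rewrite fineK.
pose k : R := eta^-1.
have k0 : 0 <= k by rewrite invr_ge0 ltW.
have key : \sum_i w i * q i <= P0 + eta.
  have mLB : measurable_fun setT (fun x => (L x * \1_B' x)%:E).
    by apply/measurable_EFinP; apply: measurable_funM.
  have mLk : measurable_fun setT (fun x => (k * L x)%:E).
    by apply/measurable_EFinP; apply: measurable_funM.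
  have mL2 : measurable_fun setT (fun x => (k / 2 * L x ^+ 2)%:E).
    apply/measurable_EFinP; apply: measurable_funM => //.
    exact: measurable_funX.
  have mI : measurable_fun setT (fun x => (\1_B' x + (eta + k) / 2)%:E : \bar R).
    by apply/measurable_EFinP; apply: measurable_funD.
  have EL : (\int[P]_x (k * L x)%:E = k%:E)%E.
    under eq_integral do rewrite EFinM.
    rewrite ge0_integralZl_EFin//; last 2 first.
    - by move=> x _; rewrite lee_fin.
    - exact/measurable_EFinP.
    rewrite integral_L// -[RHS]mule1; congr (_ * _)%E.
    under eq_bigr do rewrite integral_likelihood_ratio// mule1.
    by rewrite sumEFin w1.
  have ELB : (\int[P]_x (L x * \1_B' x)%:E = (\sum_i w i * q i)%:E)%E.
    transitivity (\int[P]_(x in B') (L x)%:E)%E.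
      rewrite [RHS]integral_mkcond; apply: eq_integral => x _.
      by rewrite patchE indicE; case: ifPn => _; rewrite ?mulr1 ?mulr0.
    rewrite integral_L// -sumEFin; apply: eq_bigr => i _.
    by rewrite EFinM -qE girsanov.
  have EL2 : (\int[P]_x (k / 2 * L x ^+ 2)%:E <= (k / 2 * (1 + eta ^+ 2))%:E)%E.
    under eq_integral do rewrite EFinM.
    rewrite ge0_integralZl_EFin//; last 3 first.
    - by move=> x _; rewrite lee_fin sqr_ge0.
    - by apply/measurable_EFinP; exact: measurable_funX.
    - by rewrite divr_ge0.
    by rewrite integral_L2 -EFinM lee_fin ler_wpM2l// divr_ge0.
  have EI : (\int[P]_x (\1_B' x + (eta + k) / 2)%:E = (P0 + (eta + k) / 2)%:E)%E.
    under eq_integral do rewrite EFinD.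
    rewrite ge0_integralD//; last 2 first.
    - exact/measurable_EFinP.
    - by move=> x _; rewrite lee_fin divr_ge0// addr_ge0// ltW.
    rewrite integral_indic// setIT. rewrite integral_cst//= probability_setT mule1.
    by rewrite EFinD P0E.
  have : (\int[P]_x ((L x * \1_B' x)%:E + (k * L x)%:E) <=
          \int[P]_x ((\1_B' x + (eta + k) / 2)%:E + (k / 2 * L x ^+ 2)%:E))%E.
    apply: ge0_le_integral => //.
    - by move=> x _; rewrite -EFinD lee_fin addr_ge0// mulr_ge0.
    - exact: emeasurable_funD.
    - exact: emeasurable_funD.
    - move=> x _; rewrite -!EFinD lee_fin.
      have ke : k * eta = 1 by rewrite mulVf// gt_eqF.
      have : 0 <= k / 2 * (L x - 1 - eta) ^+ 2 by rewrite mulr_ge0 ?sqr_ge0 ?divr_ge0.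
      have : 0 <= k / 2 * (L x - 1) ^+ 2 by rewrite mulr_ge0 ?sqr_ge0 ?divr_ge0.
      (* The gap is this square on the region; off it, the next one plus eta / 2. *)
      have -> : k / 2 * (L x - 1 - eta) ^+ 2 =
          k / 2 * L x ^+ 2 - k * L x + k / 2 - (k * eta) * L x + k * eta
          + (k * eta) * eta / 2 by field.
      have -> : k / 2 * (L x - 1) ^+ 2 = k / 2 * L x ^+ 2 - k * L x + k / 2 by field.
      rewrite ke indicE; case: (_ \in _) => /=; lra.
  rewrite ge0_integralD//; last 2 first.
  - by move=> x _; rewrite lee_fin mulr_ge0.
  - by move=> x _; rewrite lee_fin mulr_ge0.
  rewrite ge0_integralD//; last 2 first.
  - by move=> x _; rewrite lee_fin addr_ge0// divr_ge0// addr_ge0// ltW.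
  - by move=> x _; rewrite lee_fin mulr_ge0 ?sqr_ge0 ?divr_ge0.
  rewrite ELB EL EI => /le_trans/(_ (leeD2l _ EL2)).
  rewrite -!EFinD lee_fin.
  have -> : k / 2 * (1 + eta ^+ 2) = k / 2 + (k * eta) * eta / 2 by field.
  by rewrite mulVf ?gt_eqF//; lra.
have : ((\sum_i w i * (1 - q i))%:E <= M)%E.
  apply: convex_combination_le => // i wi.
  by rewrite EFinB -qE -lawC -nB; exact: lawM.
move=> /(leeD2l (law W n (cst 0) B)); apply: le_trans.
rewrite -[law W n (cst 0) B]fineK// -/P0 -EFinD lee_fin.
under eq_bigr do rewrite mulrBr mulr1.
rewrite sumrB w1; lra.
Qed.

End mixture.

(** * Square-integrable functions of one coordinate of the cube *)

Lemma Rintegral_sum d (T : measurableType d) (R : realType)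
    (m : {measure set T -> \bar R}) (I : Type) (s : seq I) (f : I -> T -> R) :
  (forall i, m.-integrable setT (EFin \o f i)) ->
  \int[m]_x (\sum_(i <- s) f i x) = \sum_(i <- s) \int[m]_x f i x.
Proof.
move=> fint; rewrite /Rintegral sum_fine; last first.
  by move=> i _; apply: integrable_fin_num => //; exact: fint.
rewrite -integral_sum//; congr fine; apply: eq_integral => x _.
by rewrite sumEFin.
Qed.

Section prod_law_coordinates.
Context d (T : measurableType d) (R : realType) (P : probability T R).
Variable n : nat.
Local Notation Pn := (prod_law P n).

Lemma prod_law_tnth j (A : set T) : measurable A ->
  Pn [set x | A (tnth x j)] = P A.
Proof.
move=> mA; pose B i := if i == j then A else setT.
rewrite (_ : mkset _ = [set x | forall i, B i (tnth x i)]); last first.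
  apply/seteqP; split=> [x xA i|x /(_ j)]; rewrite /B/= ?eqxx//.
  by case: eqP => // ->.
rewrite prod_law_box; last by move=> i; rewrite /B; case: ifP.
rewrite (bigD1 j)//= big1 ?mule1 /B ?eqxx// => i /negbTE ->.
exact: probability_setT.
Qed.

Lemma prod_law_tnth2 i j (A B : set T) : i != j -> measurable A ->
  measurable B ->
  Pn [set x | A (tnth x i) /\ B (tnth x j)] = (P A * P B)%E.
Proof.
move=> ij mA mB.
pose C k := if k == i then A else if k == j then B else setT.
have Cj : C j = B by rewrite /C eq_sym (negbTE ij) eqxx.
have Ci : C i = A by rewrite /C eqxx.
rewrite (_ : mkset _ = [set x | forall k, C k (tnth x k)]); last first.
  apply/seteqP; split=> [x [xA xB] k|x xC]; last first.
    by split; [have := xC i; rewrite Ci|have := xC j; rewrite Cj].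
  by rewrite /C; case: eqP => [->//|_]; case: eqP => [->|].
rewrite prod_law_box; last by move=> k; rewrite /C; do 2 case: ifP => //.
rewrite (bigD1 i)//= (bigD1 j) 1?eq_sym//= Ci Cj big1 ?mule1// => k.
move=> /andP[/negbTE ki /negbTE kj]; rewrite /C ki kj.
exact: probability_setT.
Qed.

Lemma ge0_integral_tnth j (u : T -> \bar R) : measurable_fun setT u ->
  (forall x, 0 <= u x)%E ->
  (\int[Pn]_x u (tnth x j) = \int[P]_t u t)%E.
Proof.
move=> mu u0.
rewrite -[LHS](ge0_integral_pushforward (@measurable_tnth _ T n j) _ measurableT)//.
apply: eq_measure_integral; first exact: measurable_tnth.
by move=> ? A mA _; exact: prod_law_tnth.
Qed.

Lemma Lfun2_tnth j (u : T -> R) : u \in Lfun P 2%:E ->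
  (fun x => u (tnth x j)) \in Lfun Pn 2%:E.
Proof.
rewrite !inE/= => /andP[/[!inE]/= mu u2].
apply/andP; split; rewrite inE/=.
  by apply: (measurableT_comp mu); exact: measurable_tnth.
move: u2; rewrite /finite_norm unlock /Lnorm/=; congr (_ `^ _ < _)%E.
rewrite (ge0_integral_tnth j (u := fun t => (`|u t| `^ 2)%:E))//.
apply/measurable_EFinP.
apply: (@measurableT_comp _ _ _ _ _ _ (@powR R ^~ 2)) => //.
exact: measurableT_comp.
Qed.

Lemma Lfun2_integrableM (m : probability T R) (u v : T -> R) :
  u \in Lfun m 2%:E -> v \in Lfun m 2%:E ->
  m.-integrable setT (EFin \o (u \* v)).
Proof. by move=> u2 v2; apply/Lfun1_integrable; exact: Lfun2_mul_Lfun1. Qed.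

Lemma Lfun2_integrable (m : probability T R) (u : T -> R) :
  u \in Lfun m 2%:E -> m.-integrable setT (EFin \o u).
Proof.
move=> u2; apply/Lfun1_integrable; apply: (Lfun_subset12 _ u2).
exact: fin_num_measure.
Qed.

End prod_law_coordinates.

Section prod_law_dot.
Context d (T : measurableType d) (R : realType) (P : probability T R).
Variable n : nat.
Local Notation Pn := (prod_law P n).

Lemma dotL2_tnth j (u v : T -> R) :
  u \in Lfun P 2%:E -> v \in Lfun P 2%:E ->
  dotL2 Pn (fun x => u (tnth x j)) (fun x => v (tnth x j)) = dotL2 P u v.
Proof.
move=> u2 v2; rewrite /dotL2 /Rintegral; congr fine.
have iuv := Lfun2_integrableM u2 v2.
have muv : measurable_fun setT (EFin \o (u \* v)) by exact: measurable_int iuv.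
rewrite -[LHS](integral_pushforward (@measurable_tnth _ T n j)
  (f := EFin \o (u \* v)) muv _ measurableT).
  apply: eq_measure_integral; first exact: measurable_tnth.
by move=> ? A mA _; exact: prod_law_tnth.
exact: (Lfun2_integrableM (Lfun2_tnth j u2) (Lfun2_tnth j v2)).
Qed.

(** Two distinct coordinates are independent, so the integral factorizes, and
    one factor vanishes. *)
Lemma dotL2_tnth_neq i j (u v : T -> R) : i != j ->
  u \in Lfun P 2%:E -> v \in Lfun P 2%:E -> \int[P]_t v t = 0 ->
  dotL2 Pn (fun x => u (tnth x i)) (fun x => v (tnth x j)) = 0.
Proof.
move=> ij u2 v2 v0; rewrite /dotL2 /Rintegral.
have iu := Lfun2_integrable u2; have iv := Lfun2_integrable v2.
have mu : measurable_fun setT u by apply/measurable_EFinP; exact: measurable_int iu.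
have mv : measurable_fun setT v by apply/measurable_EFinP; exact: measurable_int iv.
pose F (z : T * T) : \bar R := (u z.1 * v z.2)%:E.
have mF : measurable_fun setT F.
  by apply/measurable_EFinP; apply: measurable_funM; apply: measurableT_comp.
pose X (x : n.-tuple T) := (tnth x i, tnth x j).
have mX : measurable_fun setT X.
  by apply/measurable_fun_pairP; split; exact: measurable_tnth.
have iF : (P \x P)%E.-integrable setT F.
  apply/integrable12ltyP => //.
  have finite_norm1 h : P.-integrable setT (EFin \o h) ->
      (\int[P]_t (`|h t|)%:E < +oo)%E.
    by move=> /integrableP[_].
  have finv := finite_norm1 _ iv.
  rewrite (eq_integral (fun x => (`|u x|)%:E * \int[P]_y (`|v y|)%:E)%E).
    rewrite ge0_integralZr//.
    - rewrite lte_mul_pinfty ?integral_ge0//.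
      by rewrite ge0_fin_numE ?integral_ge0//; exact: finite_norm1.
    - by apply/measurable_EFinP; exact: measurableT_comp.
    - exact: integral_ge0.
  move=> x _; rewrite -ge0_integralZl_EFin//.
    by apply: eq_integral => y _; rewrite /F /= normrM EFinM.
  by apply/measurable_EFinP; exact: measurableT_comp.
have -> : (\int[Pn]_x (u (tnth x i) * v (tnth x j))%:E =
    \int[P \x P]_z F z)%E.
  rewrite -[LHS](integral_pushforward mX (f := F) mF _ measurableT); last first.
    exact: (Lfun2_integrableM (Lfun2_tnth i u2) (Lfun2_tnth j v2)).
  apply: eq_measure_integral => A mA _; apply/esym.
  apply: product_measure_unique => // B C mB mC.
  exact: prod_law_tnth2.
rewrite -integral12_prod_meas1//.
rewrite integral0_eq//= => x _; rewrite /fubini_F /F/=.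
under eq_integral do rewrite EFinM.
rewrite integralZl// (_ : (\int[P]_y (v y)%:E = 0)%E) ?mule0//.
by rewrite -[LHS]fineK ?integrable_fin_num//; congr _%:E.
Qed.

End prod_law_dot.

(** * Finite expansions in square-integrable functions *)

Section orthonormal_family.
Context d (T : measurableType d) (R : realType) (m : probability T R).
Implicit Types u v : T -> R.

Lemma normL2E u : u \in Lfun m 2%:E ->
  normL2 m u = (Num.sqrt (dotL2 m u u))%:E.
Proof.
move=> u2; rewrite /normL2 unlock /Lnorm /= /dotL2.
under eq_integral do rewrite powR_mulrn// real_normK ?num_real//.
have iu : m.-integrable setT (EFin \o (fun x => u x ^+ 2)).
  exact: Lfun2_integrable_sqr.
have -> : (\int[m]_x (u x ^+ 2)%:E)%E = (\int[m]_x (u x * u x))%:E.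
  rewrite /Rintegral fineK//; exact: (integrable_fin_num measurableT iu).
by rewrite poweR_EFin powR12_sqrt// Rintegral_ge0// => x _; rewrite -expr2 sqr_ge0.
Qed.

Lemma dotL2_suml (J : finType) (e : J -> T -> R) u (a : J -> R) :
  u \in Lfun m 2%:E -> (forall j, e j \in Lfun m 2%:E) ->
  dotL2 m (fun x => \sum_j a j * e j x) u = \sum_j a j * dotL2 m (e j) u.
Proof.
move=> u2 e2.
have ieu j : m.-integrable setT (EFin \o (e j \* u)) by exact: Lfun2_integrableM.
have iaeu j : m.-integrable setT (EFin \o (fun x => a j * (e j x * u x))).
  by apply: eq_integrable (integrableZl _ (a j) (ieu j)).
rewrite /dotL2.
transitivity (\int[m]_x \sum_j a j * (e j x * u x)).
  apply: eq_Rintegral => x _; rewrite mulr_suml; apply: eq_bigr => j _.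
  by rewrite mulrA.
rewrite Rintegral_sum//; apply: eq_bigr => j _.
by rewrite RintegralZl//; exact: ieu.
Qed.

Variables (J : finType) (e : J -> T -> R).
Hypothesis e2 : forall j, e j \in Lfun m 2%:E.

Lemma Lfun2_sum (a : J -> R) :
  (fun x => \sum_j a j * e j x) \in Lfun m 2%:E.
Proof.
rewrite (_ : (fun x => _) = \sum_j a j *: e j); last first.
  by apply/funext => x; rewrite fct_sumE.
have [L0 LD] := Lfun_submod_closed m (le1_2E R).
by elim/big_rec: _ => [|j u _ u2]; [exact: L0|exact: LD].
Qed.

Lemma dotL2_sum (a b : J -> R) :
  dotL2 m (fun x => \sum_j a j * e j x) (fun x => \sum_j b j * e j x) =
  \sum_i \sum_j a i * b j * dotL2 m (e i) (e j).
Proof.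
rewrite dotL2_suml//; last exact: Lfun2_sum.
apply: eq_bigr => i _.
have dotC u v : dotL2 m u v = dotL2 m v u.
  by apply: eq_Rintegral => x _; rewrite mulrC.
rewrite dotC dotL2_suml// mulr_sumr; apply: eq_bigr => j _.
by rewrite mulrA dotC.
Qed.

Lemma dotL2_orthonormal (a b : J -> R) :
  (forall i j, dotL2 m (e i) (e j) = (i == j)%:R) ->
  dotL2 m (fun x => \sum_j a j * e j x) (fun x => \sum_j b j * e j x) =
  \sum_j a j * b j.
Proof.
move=> eo; rewrite dotL2_sum; apply: eq_bigr => i _.
rewrite (bigD1 i)//= eo eqxx mulr1 big1 ?addr0// => j ji.
by rewrite eo eq_sym (negbTE ji) mulr0.
Qed.

End orthonormal_family.

(** * Additive signals in the reproducing kernel Hilbert space *)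

Section signals.
Variables (R : realType) (p N : nat).
Variables (H : set (R -> R)) (ip : (R -> R) -> (R -> R) -> R)
  (K0 : R -> R -> R) (mu : nat -> R) (psi : nat -> R -> R).
Hypotheses (H0_rkhs : is_rkhs (orth_cst1 H) ip K0)
  (H0_mercer : mercer_expansion K0 mu psi)
  (H0_norm : spectral_norm (orth_cst1 H) ip mu psi).
Hypothesis muN : forall k : 'I_N, 0 < mu k.+1.
Local Notation H0 := (orth_cst1 H).

Lemma mu_noninc k l : (0 < k)%N -> (k <= l)%N -> mu l <= mu k.
Proof.
move=> k0; elim: l => [|l IH]; first by rewrite leqn0 => /eqP <-.
rewrite leq_eqVlt => /predU1P[->//|]; rewrite ltnS => kl.
by apply: le_trans (IH kl); apply: (mercer_noninc H0_mercer); exact: leq_trans kl.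
Qed.

Lemma eigen_sum_mem (a : 'I_N -> R) :
  H0 (fun t => \sum_k a k * psi k.+1 t).
Proof.
rewrite (_ : (fun t => _) = \sum_k a k *: psi k.+1); last first.
  by apply/funext => t; rewrite fct_sumE.
elim/big_rec: _ => [|k g _ Hg]; first exact: (rkhs0 H0_rkhs).
by apply: (rkhs_lin H0_rkhs) => //; exact: (spectral_mem H0_norm).
Qed.

(** Only the first [N] terms of the spectral expansion of the norm survive, and
    each [a_k^2 / mu_{k+1}] is at most [a_k^2 / mu_nu]. *)
Lemma eigen_sum_hnorm_le1 (a : 'I_N -> R) nu : (0 < nu)%N -> 0 < mu nu ->
  (forall k : 'I_N, (nu <= k)%N -> a k = 0) -> \sum_k a k ^+ 2 <= mu nu ->
  hnorm ip (fun t => \sum_k a k * psi k.+1 t) <= 1.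
Proof.
move=> nu0 munu a0 sa; set g := fun t => _.
have Hg : H0 g by exact: eigen_sum_mem.
rewrite -(@expr_le1 _ 2)// ?sqrtr_ge0// -lee_fin (spectral_normE H0_norm Hg).
have psi2 k : (0 < k)%N -> psi k \in Lfun (@leb01 R) 2%:E.
  exact: (mercer_L2 H0_mercer).
have dotg k : (0 < k)%N ->
    dotL2 (@leb01 R) g (psi k) = \sum_(l < N | l.+1 == k) a l.
  move=> k0; rewrite /g dotL2_suml//; last 2 first.
  - exact: psi2.
  - by move=> j; exact: psi2.
  rewrite [RHS]big_mkcond/=; apply: eq_bigr => l _.
  rewrite (mercer_orthonormal H0_mercer)//.
  by case: ifP; rewrite ?mulr1 ?mulr0.
pose t k : \bar R := ((dotL2 (@leb01 R) g (psi k) ^+ 2)%:E / (mu k)%:E)%E.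
have t0 k : (N < k)%N -> t k = 0%E.
  move=> Nk; rewrite /t dotg ?(leq_ltn_trans _ Nk)// big1 ?expr0n ?mul0e//.
  by move=> l /eqP lk; have := ltn_ord l; rewrite ltnNge -ltnS lk Nk.
have tE (k : 'I_N) : (t k.+1 <= (a k ^+ 2 / mu nu)%:E)%E.
  rewrite /t dotg// (bigD1 k)//= big1 ?addr0; last first.
    by move=> l /andP[/eqP[lk]]; rewrite -val_eqE/= lk eqxx.
  rewrite inver gt_eqF ?muN// -EFinM lee_fin.
  have [nuk|knu] := leqP nu k; first by rewrite a0// expr0n/= !mul0r.
  by rewrite ler_wpM2l ?sqr_ge0// lef_pV2 ?posrE ?muN//; exact: mu_noninc.
rewrite (_ : (\big[_/_]_(1 <= k <oo | true) _)%E = (\sum_(k < N) t k.+1)%E).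
  apply: (@le_trans _ _ (\sum_(k < N) (a k ^+ 2 / mu nu)%:E)%E).
    by apply: lee_sum => k _.
  rewrite sumEFin lee_fin -mulr_suml ler_pdivrMr// mul1r//.
apply: lim_near_cst => //; near=> n.
rewrite -/t (@big_cat_nat _ _ _ N.+1)//=; last by near: n; exists N.+1.
rewrite big_add1 big_mkord [X in (_ + X)%E]big1_seq ?adde0// => k.
by rewrite mem_index_iota => /and3P[_ Nk _]; exact: t0.
Unshelve. all: by end_near.
Qed.

(** Coefficients are indexed from 0 while eigenfunctions are indexed from 1,
    whence the shift in [psi jk.2.+1]. *)
Definition signal (theta : 'I_p * 'I_N -> R) (x : p.-tuple R) : R :=
  \sum_jk theta jk * psi jk.2.+1 (tnth x jk.1).

Lemma signal_L2 theta : signal theta \in Lfun (leb_cube R p) 2%:E.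
Proof.
pose e (jk : 'I_p * 'I_N) (x : p.-tuple (measurableTypeR R)) :=
  psi jk.2.+1 (tnth x jk.1).
have e2 jk : e jk \in Lfun (leb_cube R p) 2%:E.
  by apply: Lfun2_tnth; exact: (mercer_L2 H0_mercer).
exact: (Lfun2_sum e2 theta).
Qed.

(** The functions [psi_k(x_j)] are orthonormal on the cube: on one coordinate
    because the [psi_k] are, and across coordinates because the [psi_k] are
    orthogonal to constants. *)
Lemma dotL2_signal theta theta' :
  dotL2 (leb_cube R p) (signal theta) (signal theta') =
  \sum_jk theta jk * theta' jk.
Proof.
have psi2 (k : 'I_N) : psi k.+1 \in Lfun (@leb01 R) 2%:E.
  exact: (mercer_L2 H0_mercer).
pose e (jk : 'I_p * 'I_N) (x : p.-tuple (measurableTypeR R)) :=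
  psi jk.2.+1 (tnth x jk.1).
have e2 jk : e jk \in Lfun (leb_cube R p) 2%:E by exact: Lfun2_tnth.
apply: (dotL2_orthonormal e2).
move=> [i k] [j l] /=; rewrite xpair_eqE.
have [<-{j}|ij] := eqVneq i j.
  rewrite (dotL2_tnth (P := @leb01 R) i (psi2 k) (psi2 l)).
  by rewrite (mercer_orthonormal H0_mercer)// eqSS.
apply: (dotL2_tnth_neq (P := @leb01 R) ij (psi2 k) (psi2 l)).
have [_ <-] := spectral_mem H0_norm (ltn0Sn l) (muN l).
by apply: eq_Rintegral => t _; rewrite mulr1.
Qed.

Lemma signal_sparse theta (S : {set 'I_p}) s nu : (#|S| <= s)%N ->
  (0 < nu)%N -> 0 < mu nu ->
  (forall j k, j \notin S -> theta (j, k) = 0) ->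
  (forall j (k : 'I_N), (nu <= k)%N -> theta (j, k) = 0) ->
  (forall j, \sum_k theta (j, k) ^+ 2 <= mu nu) ->
  sparse_class H0 ip p s (signal theta).
Proof.
move=> Ss nu0 munu thetaS thetanu theta_le; exists S => //.
exists (fun j t => \sum_k theta (j, k) * psi k.+1 t) => [j jS|x].
  split; first exact: eigen_sum_mem.
  by apply: (eigen_sum_hnorm_le1 nu0) => // k; exact: thetanu.
transitivity (\sum_j \sum_k theta (j, k) * psi k.+1 (tnth x j)).
  by rewrite pair_bigA /=; apply: eq_bigr => -[j k].
rewrite [RHS]big_mkcond/=; apply: eq_bigr => j _; case: ifPn => // jS.
by rewrite big1// => k _; rewrite thetaS// mul0r.
Qed.

End signals.

(** * Random signs and random supports *)

Section random_signs.
Variable R : realType.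

(** The constant 2 replaces the optimal 1/2 in exchange for an elementary proof:
    for [x^2 <= 1/2], [cosh x <= 1 / (1 - x^2) <= 1 + 2 x^2], from
    [exp y <= 1 / (1 - y)]; for larger [x], already [|x| <= 2 x^2]. *)
Lemma cosh_le_expR (x : R) : (expR x + expR (- x)) / 2 <= expR (2 * x ^+ 2).
Proof.
have [x2|x2] := leP (x ^+ 2) (2^-1).
  have ex (y : R) : y ^+ 2 <= 2^-1 -> expR y <= (1 - y)^-1.
    move=> y2; have y1 : 0 < 1 - y by nra.
    rewrite -[y in expR y]opprK expRN lef_pV2 ?posrE ?expR_gt0//.
    by have := expR_ge1Dx (- y); lra.
  have x1 : 0 < 1 - x by nra.
  have x1' : 0 < 1 + x by nra.
  apply: (@le_trans _ _ (1 + 2 * x ^+ 2)); last exact: expR_ge1Dx.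
  have := ex x x2; have := ex (- x); rewrite sqrrN opprK => /(_ x2).
  move=> h1 h2; apply: (@le_trans _ _ (((1 - x)^-1 + (1 + x)^-1) / 2)); first lra.
  have -> : ((1 - x)^-1 + (1 + x)^-1) / 2 = (1 - x ^+ 2)^-1.
    by field; rewrite !gt_eqF//; nra.
  have x3 : 0 < 1 - x ^+ 2 by lra.
  rewrite -[leLHS]mul1r ler_pdivrMr//; have := sqr_ge0 x; nra.
have h (y : R) : y ^+ 2 = x ^+ 2 -> expR y <= expR (2 * x ^+ 2).
  by move=> yx; rewrite ler_expR -yx; rewrite -yx in x2; nra.
have := h x erefl; have := h (- x); rewrite sqrrN => /(_ erefl); lra.
Qed.

Lemma random_signs_mgf (J : finType) (x : J -> R) :
  \sum_(r : {ffun J -> bool}) expR (\sum_j x j * (-1) ^+ r j)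
  <= 2 ^+ #|J| * expR (2 * \sum_j x j ^+ 2).
Proof.
under eq_bigr do rewrite expR_sum.
rewrite -(bigA_distr_bigA (fun j (b : bool) => expR (x j * (-1) ^+ b))).
rewrite -prodr_const mulr_sumr expR_sum -big_split/=.
apply: ler_prod => j _; apply/andP; split.
  by apply: sumr_ge0 => b _; exact: expR_ge0.
rewrite big_bool/= expr1 expr0 mulr1 mulrN1.
by have := cosh_le_expR (x j); lra.
Qed.

End random_signs.

Section random_support.
Variable R : realType.

(** Cut [s * (p %/ s)] coordinates into [s] blocks of length [m = p %/ s] and
    draw one coordinate in each block, independently and uniformly.  The hits of
    [T] in the blocks are independent, with probabilities of sum at most
    [|T| / m], and [1 / m <= 2 s / p].  Independence makes the exponential
    moment a product, for an arbitrary fixed set [T]; a uniform random subset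
    of size [s] would not have this property. *)
Lemma random_support (p s : nat) : (0 < s <= p)%N ->
  exists w : {set 'I_p} -> R,
    [/\ forall S, 0 <= w S, \sum_S w S = 1, forall S, 0 < w S -> #|S| = s &
      forall (l : R) (T : {set 'I_p}), 0 <= l ->
        \sum_S w S * expR (l * #|S :&: T|%:R)
        <= expR ((expR l - 1) * (2 * s%:R * #|T|%:R / p%:R))].
Proof.
case/andP=> s0 sp; pose m := (p %/ s)%N.
have m0 : (0 < m)%N by rewrite divn_gt0.
have smp : (s * m <= p)%N by rewrite mulnC leq_divM.
have posP (i : 'I_s) (a : 'I_m) : (i * m + a < p)%N.
  apply: leq_trans smp; have := ltn_ord i; have := ltn_ord a.
  by move=> am ism; apply: (@leq_trans (i.+1 * m)%N); [lia|rewrite leq_mul2r ism orbT].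
pose pos i a := Ordinal (posP i a).
have pos_inj i j a b : pos i a = pos j b -> i = j /\ a = b.
  move=> /(congr1 val)/= ij.
  have hi : i = j :> nat.
    by have := congr1 (divn^~ m) ij; rewrite !divnMDl// !divn_small// !addn0.
  split; apply/val_inj => //=; move: ij; rewrite hi => /addnI //.
pose supp (J : {ffun 'I_s -> 'I_m}) : {set 'I_p} := [set pos i (J i) | i : 'I_s].
have card_supp J : #|supp J| = s.
  by rewrite card_imset ?card_ord// => i j /pos_inj[].
(* M is the number of choice functions J, of support supp J. *)
pose M : R := m%:R ^+ s.
have M0 : 0 < M by rewrite exprn_gt0// ltr0n.
pose w (S : {set 'I_p}) : R := #|[set J | supp J == S]%SET|%:R / M.
have wE (F : {set 'I_p} -> R) : \sum_S w S * F S = (\sum_J F (supp J)) / M.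
  rewrite (partition_big supp xpredT)//= mulr_suml; apply: eq_bigr => S _.
  rewrite (eq_bigr (fun=> F S)); last by move=> J /eqP ->.
  rewrite (eq_bigl (fun J => J \in [set J | supp J == S]%SET)); last by move=> J; rewrite !inE.
  by rewrite sumr_const -mulr_natl /w mulrAC.
exists w; split.
- by move=> S; rewrite divr_ge0// ltW.
- have := wE (fun=> 1); under eq_bigr do rewrite mulr1; move=> ->.
  by rewrite sumr_const card_ffun !card_ord natrX divff// gt_eqF.
- move=> S; rewrite /w; case: (set_0Vmem [set J | supp J == S]%SET) => [->|[J]].
    by rewrite cards0 mul0r ltxx.
  by rewrite inE => /eqP <- _.
move=> l T l0; rewrite wE.
pose t (i : 'I_s) := #|[set a : 'I_m | pos i a \in T]%SET|.
have sumt : (\sum_i t i <= #|T|)%N.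
  have -> : (\sum_i t i = #|[set ia : 'I_s * 'I_m | pos ia.1 ia.2 \in T]%SET|)%N.
    rewrite -sum1dep_card (eq_bigr (fun i => \sum_(a | pos i a \in T) 1)%N).
      by rewrite pair_big_dep.
    by move=> i _; rewrite sum1dep_card.
  rewrite -(card_imset _ (f := fun ia : 'I_s * 'I_m => pos ia.1 ia.2)); last first.
    by move=> [i a] [j b] /pos_inj[/= -> ->].
  apply: subset_leq_card; apply/fintype.subsetP => _ /imsetP[ia + ->].
  by rewrite inE.
have cardI J : #|supp J :&: T| = (\sum_i (pos i (J i) \in T))%N.
  rewrite -sum1_card.
  rewrite (eq_bigl (fun x => (x \in supp J) && (x \in T))); last first.
    by move=> x; rewrite inE.
  rewrite big_mkcondr big_imset/=; last by move=> i j _ _ /pos_inj[].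
  by apply: eq_bigr => i _; case: (_ \in T).
have ml0 : 0 <= expR l - 1 by rewrite subr_ge0 -expR0 ler_expR.
have p0 : (0 < p)%N by exact: leq_trans sp.
have msp : m%:R^-1 <= 2 * s%:R / p%:R :> R.
  rewrite ler_pdivlMr ?ltr0n// mulrC ler_pdivrMr ?ltr0n// -!natrM ler_nat.
  have := divn_eq p s; have := ltn_pmod p s0; rewrite -/m; nia.
apply: (@le_trans _ _ (expR ((expR l - 1) * (#|T|%:R / m%:R)))); last first.
  rewrite ler_expR ler_wpM2l// mulrAC mulrC ler_wpM2r//.
rewrite ler_pdivrMr//.
under eq_bigr do rewrite cardI natr_sum mulr_sumr expR_sum.
rewrite -(bigA_distr_bigA (fun i a => expR (l * (pos i a \in T)%:R))).
have sumE i : \sum_a expR (l * (pos i a \in T)%:R) =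
    m%:R * (1 + (expR l - 1) * ((t i)%:R / m%:R)).
  rewrite (eq_bigr (fun a => 1 + (expR l - 1) * (pos i a \in T)%:R)); last first.
    by move=> a _; case: (_ \in T); rewrite ?mulr1 ?mulr0 ?expR0; lra.
  rewrite big_split/= sumr_const card_ord -mulr_sumr -natr_sum.
  rewrite mulrDr mulr1 mulrCA; congr (_ + _ * _).
  rewrite mulrC divfK ?pnatr_eq0 -?lt0n// /t -sum1dep_card [in RHS]big_mkcond/=.
  by congr _%:R; apply: eq_bigr => a _; case: (_ \in T).
under eq_bigr do rewrite sumE.
rewrite big_split/= prodr_const card_ord -/M mulrC ler_pM2r//.
apply: (@le_trans _ _ (\prod_(i < s) expR ((expR l - 1) * ((t i)%:R / m%:R)))).
  apply: ler_prod => i _; rewrite expR_ge1Dx andbT.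
  by rewrite addr_ge0// mulr_ge0// divr_ge0.
rewrite -expR_sum ler_expR -mulr_sumr ler_wpM2l// -mulr_suml.
by rewrite ler_wpM2r ?invr_ge0// -natr_sum ler_nat.
Qed.

End random_support.

(** * Effective dimension and dyadic scales *)

Section adaptation_scales.
Variables (R : realType) (mu : nat -> R) (p n : nat).
Hypotheses (p_gt0 : (0 < p)%N) (n_gt0 : (0 < n)%N).
Hypothesis mu_le : forall k l, (0 < k)%N -> (k <= l)%N -> mu l <= mu k.
Hypothesis mu1 : mu 1%N = 1.
Local Notation noise := (noise_level p n).
Local Notation nuH := (nuH mu p n).
Local Notation GammaH := (GammaH mu p n).
Local Notation A := (AH mu p n).

Lemma signal_ratio_gt0 s (a : R) : (0 < s)%N -> 0 < a ->
  0 < p%:R * a / s%:R ^+ 2 :> R.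
Proof. by move=> s0 a0; rewrite divr_gt0 ?mulr_gt0 ?exprn_gt0 ?ltr0n. Qed.

Lemma ln1_ratio_gt0 s (a : R) : (0 < s)%N -> 0 < a ->
  0 < ln (1 + p%:R * a / s%:R ^+ 2) :> R.
Proof. by move=> s0 a0; rewrite ln_gt0// ltrDl signal_ratio_gt0. Qed.

Lemma noise_level_sq s a k : (0 < s)%N -> 0 < a ->
  noise s a k ^+ 2 = k%:R * ln (1 + p%:R * a / s%:R ^+ 2) / n%:R ^+ 2 :> R.
Proof.
move=> s0 a0; rewrite /noise_level expr_div_n sqr_sqrtr// mulr_ge0//.
exact/ltW/ln1_ratio_gt0.
Qed.

Lemma noise_level_ge0 s (a : R) k : 0 <= noise s a k.
Proof. by rewrite divr_ge0// sqrtr_ge0. Qed.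

Lemma noise_level_le s (a : R) k l : (0 < s)%N -> 0 < a -> (k <= l)%N ->
  noise s a k <= noise s a l.
Proof.
move=> s0 a0 kl; rewrite ler_wpM2r ?invr_ge0// ler_wsqrtr// ler_wpM2r ?ler_nat//.
exact/ltW/ln1_ratio_gt0.
Qed.

(** The minimum exists since the noise level grows without bound, while the
    eigenvalues are at most 1. *)
Lemma nuHP s (a : R) : (0 < s)%N -> 0 < a ->
  [/\ (0 < nuH s a)%N, mu (nuH s a) <= noise s a (nuH s a) &
    forall k, (0 < k)%N -> mu k <= noise s a k -> (nuH s a <= k)%N].
Proof.
move=> s0 a0; set L := ln (1 + p%:R * a / s%:R ^+ 2).
have L0 : 0 < L by exact: ln1_ratio_gt0.
have exk : exists k, (0 < k)%N && (mu k <= noise s a k).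
  have b0 : 0 <= n%:R ^+ 2 / L by rewrite divr_ge0 ?sqr_ge0// ltW.
  have := archi_boundP b0; set N := Num.Def.archi_bound _ => bN.
  have N0 : (0 < N)%N by rewrite -(ltr0n R); exact: le_lt_trans bN.
  exists N; rewrite N0/=; apply: (@le_trans _ _ 1); first by rewrite -mu1 mu_le.
  rewrite -(@expr_ge1 _ 2)// ?noise_level_ge0// noise_level_sq//.
  rewrite ler_pdivlMr ?exprn_gt0 ?ltr0n// mul1r -/L.
  by rewrite -ler_pdivrMr// ltW.
have : exists k, [/\ (0 < k)%N, mu k <= noise s a k &
    forall l, (0 < l)%N -> mu l <= noise s a l -> (k <= l)%N].
  have [k /andP[k0 muk] kmin] := ex_minnP exk.
  by exists k; split=> // l l0 mul; apply: kmin; rewrite l0.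
exact: getPex.
Qed.

(** Each sparsity has a single dyadic scale, the power of 2 rounding [nuH] up;
    so there are at most [p] scales, whatever [a]. *)
Lemma dyadic_scales_sub (a : R) S : 0 < a -> S `<=` sparsities p ->
  dyadic_scales mu p n a S `<=`
  [set` [fset (2 ^ up_log 2 (nuH s a))%N | s in iota 1 p]%fset].
Proof.
move=> a0 Sp _ /= [k [s Ss /andP[k1 k2]] <-].
have /andP[s0 sp] := Sp _ Ss.
apply/imfsetP; exists s; first by rewrite /= mem_iota s0 add1n ltnS.
congr (2 ^ _)%N.
case: k k1 k2 => [|k] k1 k2.
  have [nu0 _ _] := nuHP s0 a0.
  have -> : nuH s a = 1%N by apply/eqP; rewrite eqn_leq k2.
  by rewrite up_log1.
apply/esym/up_log_eq => //; rewrite k2 andbT.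
by move: k1; rewrite expnS ltn_pmul2l.
Qed.

Lemma finite_dyadic_scales (a : R) S : 0 < a -> S `<=` sparsities p ->
  finite_set (dyadic_scales mu p n a S).
Proof.
by move=> a0 Sp; apply: sub_finite_set (dyadic_scales_sub a0 Sp) _.
Qed.

Lemma card_dyadic_scales (a : R) S : 0 < a -> S `<=` sparsities p ->
  (#|` fset_set (dyadic_scales mu p n a S)| <= p)%N.
Proof.
move=> a0 Sp; set F := [fset (2 ^ up_log 2 (nuH s a))%N | s in iota 1 p]%fset.
apply: (@leq_trans #|` F|).
  apply: fsubset_leq_card; rewrite -[F]set_fsetK -fset_set_sub//.
  - exact: dyadic_scales_sub.
  - exact: finite_dyadic_scales.
apply: leq_trans (leq_imfset_card _ _ _) _; rewrite -[leqRHS](size_iota 1).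
apply: uniq_leq_size; first exact: enum_finmem_uniq.
by move=> s; rewrite enum_finmemE.
Qed.

(** 1 belongs to the set whose supremum is [AH], as there is at least one scale,
    and the number of scales being at most [p] bounds this set. *)
Lemma AH_ge1 : 1 <= A.
Proof.
apply: ub_le_sup; last first.
  split=> //; rewrite /log_card.
  have s1 : sparsities p 1%N by rewrite /sparsities/= p_gt0.
  have [nu0 _ _] := nuHP (ltn0Sn 0) (@ltr01 R).
  have [k kP] : exists k, ((2 ^ k < 2 * nuH 1 1) && (nuH 1 1 <= 2 ^ k))%N.
    have [nu1|nu1] := leqP (nuH 1 1) 1.
      by exists 0%N; rewrite expn0 nu1 andbT; exact: leq_pmulr.
    have /andP[u1 u2] := up_log_bounds (isT : (1 < 2)%N) nu1.
    exists (up_log 2 (nuH 1 1)); rewrite u2 andbT.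
    have : (0 < up_log 2 (nuH 1 1))%N by rewrite up_log_gt0.
    by case: up_log u1 u2 => // j; rewrite expnS ltn_pmul2l.
  have Vk : dyadic_scales mu p n 1 (sparsities p) (2 ^ k)%N.
    by exists k => //; exists 1%N.
  have fin : finite_set (dyadic_scales mu p n 1 (sparsities p)).
    exact: finite_dyadic_scales.
  have V0 : (0 < #|` fset_set (dyadic_scales mu p n 1%R (sparsities p))|)%N.
    by rewrite cardfs_gt0; apply/fset0Pn; exists (2 ^ k)%N; rewrite in_fset_set// inE.
  rewrite lnM ?posrE ?expR_gt0 ?ltr0n// expRK lerDl ln_ge0//.
  by rewrite ler1n.
exists (ln (expR 1 * p%:R)) => a /= [a1 aV]; apply: le_trans aV _.
have a0 : 0 < a by exact: lt_le_trans a1.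
have VP := @card_dyadic_scales a (sparsities p) a0 (fun=> id).
rewrite /log_card; case: #|` _| VP => [|c] VP.
  rewrite mulr0 ln0// ln_ge0// -[leLHS]mul1r ler_pM//.
    by rewrite -expR0 ler_expR.
  by rewrite ler1n.
by rewrite ler_ln ?posrE ?mulr_gt0 ?expR_gt0 ?ltr0n// ler_wpM2l ?expR_ge0// ler_nat.
Qed.
Hypothesis n_large : ln (1 + p%:R * A) <= n%:R / 2.

Let A_gt0 : 0 < A. Proof. exact: lt_le_trans ltr01 AH_ge1. Qed.

(** The noise level of dimension 1 is below [mu 1 = 1] when [n] is large. *)
Lemma nuH_gt1 s : (0 < s)%N -> (1 < nuH s A)%N.
Proof.
move=> s0; have [nu0 munu _] := nuHP s0 A_gt0.
rewrite ltn_neqAle nu0 andbT; apply/negP => /eqP nu1.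
move: munu; rewrite -nu1 mu1; apply/negP; rewrite -ltNge.
rewrite -(@expr_lt1 _ 2)// ?noise_level_ge0// noise_level_sq// mul1r.
rewrite ltr_pdivrMr ?exprn_gt0 ?ltr0n// mul1r.
have Ln : ln (1 + p%:R * A / s%:R ^+ 2) <= n%:R / 2.
  apply: le_trans n_large; rewrite ler_ln ?posrE; last 2 first.
  - by rewrite addr_gt0// signal_ratio_gt0.
  - by rewrite addr_gt0// mulr_gt0 ?ltr0n.
  rewrite lerD2l ler_pdivrMr ?exprn_gt0 ?ltr0n// ler_peMr ?mulr_ge0//.
    exact/ltW.
  by rewrite exprn_ege1// ler1n.
apply: le_lt_trans Ln _.
have n1 : 1 <= n%:R :> R by rewrite ler1n.
by nra.
Qed.

(** At [nu], one below the crossing point [nuH], the eigenvalue still exceeds the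
    noise level.  The elements of the set defining [GammaH] are at most the noise
    level of dimension [nu] before the crossing, and at most the eigenvalue at
    [nu + 1], hence the noise level of dimension [nu + 1 <= 2 nu], after it.  So
    [GammaH] is at most [sqrt 2] times the noise level of dimension [nu]. *)
Lemma effective_dimension s : (0 < s)%N -> let nu := (nuH s A).-1 in
  [/\ (0 < nu)%N, 0 < mu nu, 0 <= GammaH s A,
      GammaH s A ^+ 2 <= 2 * mu nu ^+ 2 &
      GammaH s A ^+ 2 <= 2 * nu%:R * (p%:R * A / s%:R ^+ 2) / n%:R ^+ 2].
Proof.
move=> s0 nu; have [nuH0 munuH nuHmin] := nuHP s0 A_gt0.
have nu1 := nuH_gt1 s0.
have nu0 : (0 < nu)%N by rewrite /nu -ltnS prednK.
have nuE : nuH s A = nu.+1 by rewrite /nu prednK.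
have noise_mu : noise s A nu < mu nu.
  rewrite ltNge; apply/negP => /(nuHmin _ nu0); rewrite nuE ltnn//.
have munu0 : 0 < mu nu by apply: le_lt_trans noise_mu; exact: noise_level_ge0.
set E := [set Num.min (mu k) (noise s A k) | k in [set k | (0 < k)%N]].
have Ene : E !=set0 by exists (Num.min (mu 1%N) (noise s A 1)), 1%N.
have Eub : ubound E (noise s A (2 * nu)).
  move=> _ [k /= k0 <-]; have [knu|nuk] := leqP k nu.
    rewrite ge_min; apply/orP; right; apply: noise_level_le => //.
    by apply: leq_trans knu _; exact: leq_pmull.
  rewrite ge_min; apply/orP; left.
  apply: (@le_trans _ _ (mu (nuH s A))); first by rewrite mu_le// nuE.
  apply: le_trans munuH _; apply: noise_level_le => //.
  by rewrite nuE mul2n -addnn -addn1 leq_add2l.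
have Gle : GammaH s A <= noise s A (2 * nu) by exact: ge_sup.
have G0 : 0 <= GammaH s A.
  apply: (@le_trans _ _ (Num.min (mu 1%N) (noise s A 1))).
    by rewrite le_min mu1 ler01 noise_level_ge0.
  by apply: ub_le_sup; [exists (noise s A (2 * nu))|exists 1%N].
have G2 : GammaH s A ^+ 2 <= noise s A (2 * nu) ^+ 2.
  by rewrite ler_sqr ?nnegrE ?noise_level_ge0.
have noise2 : noise s A (2 * nu) ^+ 2 = 2 * noise s A nu ^+ 2.
  by rewrite !noise_level_sq// natrM !mulrA.
split=> //.
  apply: le_trans G2 _; rewrite noise2 ler_pM2l// ler_sqr ?nnegrE; last 2 first.
  - exact: noise_level_ge0.
  - exact: ltW.
  exact: ltW.
apply: le_trans G2 _; rewrite noise_level_sq// natrM.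
rewrite ler_wpM2r ?invr_ge0 ?sqr_ge0// ler_wpM2l ?mulr_ge0//.
apply: le_ln1Dx; apply: lt_trans (signal_ratio_gt0 s0 A_gt0).
by rewrite oppr_lt0.
Qed.

Lemma finite_Vtilde : finite_set (Vtilde mu p n).
Proof. by apply: finite_dyadic_scales => // s []. Qed.

End adaptation_scales.

(** * Interaction of two scales *)

Section scale_sums.
Variable R : realType.
Local Notation q := (3 / 4 : R).

(** [|k - l|], the two truncated subtractions having disjoint supports. *)
Definition scale_dist (k l : nat) : nat := (k - l + (l - k))%N.

Lemma geometric_sum_le (I : finType) (Q : pred I) (g : I -> nat) :
  {in Q &, injective g} -> \sum_(i | Q i) q ^+ g i <= 4.
Proof.
move=> ginj; have q0 : 0 <= q by lra.
pose M := (\max_(i | Q i) g i).+1.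
apply: (@le_trans _ _ (\sum_(m < M) q ^+ m)); last first.
  have := subrX1 q M; have : 0 <= q ^+ M by rewrite exprn_ge0.
  by move=> qM0 h; lra.
rewrite (partition_big (fun i => inord (g i) : 'I_M) xpredT)//=.
apply: ler_sum => m _.
case: (pickP [pred i | Q i && (inord (g i) == m)]) => [i0 /= /andP[Qi0 /eqP gi0]|nom].
  have gM i : Q i -> (g i < M)%N by move=> Qi; rewrite ltnS leq_bigmax_cond.
  have gval i : Q i -> (inord (g i) : 'I_M) = m -> g i = m.
    by move=> Qi <-; rewrite inordK ?gM.
  rewrite (bigD1 i0)/= ?Qi0 ?gi0 ?eqxx// big1 ?addr0; first by rewrite gval.
  move=> i /andP[/andP[Qi /eqP gi] /eqP]; case; apply: ginj => //.
  by rewrite (gval i Qi gi) (gval i0 Qi0 gi0).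
by rewrite big_pred0// exprn_ge0.
Qed.

Lemma scale_dist_sum_le (I : finType) (kappa : I -> nat) (k : nat) :
  injective kappa -> \sum_i q ^+ scale_dist (kappa i) k <= 8.
Proof.
move=> kinj; rewrite (bigID (fun i => (k <= kappa i)%N))/=.
suff hs : \sum_(i | (k <= kappa i)%N) q ^+ scale_dist (kappa i) k <= 4 /\
          \sum_(i | ~~ (k <= kappa i)%N) q ^+ scale_dist (kappa i) k <= 4.
  by case: hs; lra.
by split; apply: geometric_sum_le => i j; rewrite /in_mem/= /scale_dist => ki kj kij;
  apply: kinj; lia.
Qed.

Lemma expR_sub1_le (x : R) : expR x - 1 <= x * expR x.
Proof.
have h : (1 - x) * expR x <= 1.
  rewrite -[leRHS](expRxMexpNx_1 x) mulrC ler_wpM2l ?expR_ge0//.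
  exact: expR_ge1Dx.
lra.
Qed.

Lemma expR_sub1_le2 (x : R) : 0 <= x <= 2^-1 -> expR x - 1 <= 2 * x.
Proof.
move=> /andP[x0 x1]; have := expR_sub1_le x; have := expR_ge0 x.
by move=> e0 h; nra.
Qed.

(** Write each term as 1 plus an excess of at most [B exp(B) q^dist].  With
    [y = ln (e |I|)] and [B <= t y <= y / 2], one has
    [B exp(B) <= t y exp(y/2) <= 2 t exp(y) = 2 t e |I|], and the [q^dist] have
    sum at most 8: the average excess is at most [16 t e]. *)
Lemma scale_average_le (I : finType) (kappa : I -> nat) (k : nat) (B t : R) :
  injective kappa -> 0 <= t <= 2^-1 ->
  0 <= B <= t * ln (expR 1 * #|I|%:R) -> (0 < #|I|)%N ->
  #|I|%:R^-1 * \sum_i expR (B * q ^+ scale_dist (kappa i) k)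
  <= 1 + 16 * t * expR 1.
Proof.
move=> kinj /andP[t0 t2] /andP[B0 Bt] I0; set y := ln _ in Bt.
have I0R : 0 < #|I|%:R :> R by rewrite ltr0n.
have yE : expR y = expR 1 * #|I|%:R by rewrite lnK// posrE mulr_gt0 ?expR_gt0.
have y0 : 0 <= y.
  by rewrite ln_ge0// -[leLHS]mul1r ler_pM// -?expR0 ?ler_expR// expR0 ler1n.
have BB : B * expR B <= 2 * t * expR y.
  have e2 : expR y = expR (y / 2) * expR (y / 2) by rewrite -expRD; congr expR; field.
  apply: (@le_trans _ _ (t * y * expR (y / 2))).
    by rewrite ler_pM ?expR_ge0// ler_expR; nra.
  have h : y <= 2 * expR (y / 2) by have := expR_ge1Dx (y / 2); lra.
  have e0 := expR_ge0 (y / 2); rewrite e2.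
  have -> : 2 * t * (expR (y / 2) * expR (y / 2)) =
    (t * (2 * expR (y / 2))) * expR (y / 2) by ring.
  by rewrite ler_wpM2r// ler_wpM2l.
have q01 d : 0 <= q ^+ d <= 1 by rewrite exprn_ge0 ?exprn_ile1//; lra.
have term i : expR (B * q ^+ scale_dist (kappa i) k) <=
    1 + 2 * t * expR y * q ^+ scale_dist (kappa i) k.
  set u := q ^+ _; have /andP[u0 u1] : 0 <= u <= 1 by exact: q01.
  have h := expR_sub1_le (B * u).
  have : B * u * expR (B * u) <= 2 * t * expR y * u.
    apply: (@le_trans _ _ (B * expR B * u)); last by rewrite ler_wpM2r.
    rewrite [leRHS]mulrAC ler_wpM2l ?mulr_ge0// ler_expR; nra.
  lra.
rewrite mulrC ler_pdivrMr//; apply: le_trans (ler_sum _ (fun i _ => term i)) _.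
rewrite big_split/= sumr_const -mulr_sumr.
have := scale_dist_sum_le k kinj; set Z := \sum_i _ => Z8.
have c0 : 0 <= 2 * t * expR y by rewrite !mulr_ge0 ?expR_ge0.
rewrite yE in c0 *.
have : 2 * t * (expR 1 * #|I|%:R) * Z <= 2 * t * (expR 1 * #|I|%:R) * 8.
  by rewrite ler_wpM2l.
lra.
Qed.

End scale_sums.

Section pairs.
Variable R : realType.
Local Notation q := (3 / 4 : R).

(** For [k <= k'], [nu <= 2^k] and [2^k' <= 4 nu'], so [nu 2^(k' - k)] is at most
    [4 nu']. *)
Lemma dyadic_ratio (k k' nu nu' : nat) : (0 < nu)%N -> (0 < nu')%N ->
  (2 ^ k < 2 * nu.+1)%N -> (nu.+1 <= 2 ^ k)%N ->
  (2 ^ k' < 2 * nu'.+1)%N -> (nu'.+1 <= 2 ^ k')%N ->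
  (minn nu nu' ^ 2 * 2 ^ scale_dist k k' <= 4 * (nu * nu'))%N.
Proof.
wlog kk' : k k' nu nu' / (k <= k')%N => [hw|] nu0 nu'0 h1 h2 h3 h4.
  have [kk'|k'k] := leqP k k'; first exact: hw.
  by rewrite minnC /scale_dist addnC (mulnC nu); apply: (hw k' k) => //; exact: ltnW.
have -> : scale_dist k k' = (k' - k)%N by rewrite /scale_dist; lia.
have h : (nu * 2 ^ (k' - k) <= 4 * nu')%N.
  apply: (@leq_trans (2 ^ k * 2 ^ (k' - k))%N); first by rewrite leq_mul2r ltnW ?orbT.
  by rewrite -expnD subnKC//; lia.
have m : (minn nu nu' <= nu)%N by exact: geq_minl.
apply: (@leq_trans (nu ^ 2 * 2 ^ (k' - k))%N).
  by rewrite leq_mul2r leq_exp2r// m orbT.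
by rewrite -mulnn -mulnA [X in (_ <= X)%N]mulnCA leq_mul2l h orbT.
Qed.

(** Put [x = p A / (s s') <= 1].  The bounds on [G] and [G'] and the ratio of the
    dimensions give [l <= 8 c^4 x q^d], where [2^-d <= q^(2d)] is used for
    [q = 3/4].  Thus [l <= 1/2], and [exp l - 1 <= 2 l]; the factor [s s' / p]
    turns [x] into [A]. *)
Lemma pair_exponent_le (A c p n s s' nu nu' m G G' : R) (d : nat) :
  0 < A -> 0 < p -> 0 < n -> 0 < s -> 0 < s' -> 0 < nu -> 0 < nu' -> 0 <= m ->
  0 <= G -> 0 <= G' -> 0 < c <= 4^-1 ->
  p * A <= s ^+ 2 -> p * A <= s' ^+ 2 ->
  G ^+ 2 <= 2 * nu * (p * A / s ^+ 2) / n ^+ 2 ->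
  G' ^+ 2 <= 2 * nu' * (p * A / s' ^+ 2) / n ^+ 2 ->
  m ^+ 2 * 2 ^+ d <= 4 * (nu * nu') ->
  let l := 2 * n ^+ 2 * (c ^+ 2 * G / nu) * (c ^+ 2 * G' / nu') * m in
  0 <= l /\ (expR l - 1) * (2 * s * s' / p) <= 32 * c ^+ 4 * A * q ^+ d.
Proof.
move=> A0 p0 n0 s0 s'0 nu0 nu'0 m0 G0 G'0 /andP[c0 c4] sA s'A GE G'E md l.
have := (ltW A0, ltW p0, ltW n0, ltW s0); move=> [[[A0' p0'] n0'] s0'].
have := (ltW s'0, ltW nu0, ltW nu'0, ltW c0); move=> [[[s'0' nu0'] nu'0'] c0'].
have l0 : 0 <= l by rewrite /l !(mulr_ge0, invr_ge0, sqr_ge0).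
split=> //.
have q0 : 0 <= q ^+ d by rewrite exprn_ge0; lra.
pose x := p * A / (s * s').
have x0 : 0 < x by rewrite divr_gt0 ?mulr_gt0.
have x1 : x <= 1.
  rewrite ler_pdivrMr ?mulr_gt0// mul1r.
  have [ss|ss] := leP s s'; first by apply: le_trans sA _; rewrite expr2 ler_wpM2l.
  by apply: le_trans s'A _; rewrite expr2 ler_wpM2r// ltW.
have mq : m ^+ 2 <= 4 * (nu * nu') * (q ^+ d) ^+ 2.
  have h : 2^-1 ^+ d <= (q ^+ d) ^+ 2 :> R.
    by rewrite exprAC lerXn2r ?nnegrE//; lra.
  apply: (@le_trans _ _ (4 * (nu * nu') * 2^-1 ^+ d)).
    by rewrite exprVn ler_pdivlMr ?exprn_gt0.
  by rewrite ler_wpM2l// !mulr_ge0 ?ltW.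
have l2 : l ^+ 2 <= (8 * c ^+ 4 * x * q ^+ d) ^+ 2.
  have -> : l ^+ 2 = 4 * n ^+ 4 * c ^+ 8 * (G ^+ 2 * G' ^+ 2) * m ^+ 2 /
      (nu ^+ 2 * nu' ^+ 2) by rewrite /l; field; rewrite !gt_eqF.
  have GG : G ^+ 2 * G' ^+ 2 <= (2 * nu * (p * A / s ^+ 2) / n ^+ 2) *
      (2 * nu' * (p * A / s' ^+ 2) / n ^+ 2) by rewrite ler_pM ?sqr_ge0.
  rewrite ler_pdivrMr ?mulr_gt0 ?exprn_gt0//.
  apply: (@le_trans _ _ (4 * n ^+ 4 * c ^+ 8 *
     ((2 * nu * (p * A / s ^+ 2) / n ^+ 2) *
      (2 * nu' * (p * A / s' ^+ 2) / n ^+ 2)) *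
     (4 * (nu * nu') * (q ^+ d) ^+ 2))).
    apply: ler_pM => //; rewrite ?sqr_ge0//.
      by rewrite !(mulr_ge0, exprn_ge0).
    by rewrite ler_wpM2l// !(mulr_ge0, exprn_ge0).
  move: (q ^+ d) => z; rewrite le_eqVlt; apply/orP; left; apply/eqP.
  by rewrite /x; field; rewrite !lt0r_neq0.
have lle : l <= 8 * c ^+ 4 * x * q ^+ d.
  move: l2; rewrite ler_sqr ?nnegrE// mulr_ge0// mulr_ge0 ?(ltW x0)//.
  by rewrite mulr_ge0// exprn_ge0.
have c4' : c ^+ 4 <= 4^-1 ^+ 4 by rewrite lerXn2r ?nnegrE.
have lh : l <= 2^-1.
  apply: le_trans lle _.
  have q1 : q ^+ d <= 1 by rewrite exprn_ile1; lra.
  have c40 : 0 <= c ^+ 4 by rewrite exprn_ge0// ltW.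
  have xq : x * q ^+ d <= 1 by rewrite mulr_ile1// ltW.
  rewrite -mulrA; apply: (@le_trans _ _ (8 * c ^+ 4 * 1)).
    by rewrite ler_wpM2l// mulr_ge0.
  by lra.
have e2 : expR l - 1 <= 2 * l by apply: expR_sub1_le2; rewrite l0.
apply: (@le_trans _ _ (2 * (8 * c ^+ 4 * x * q ^+ d) * (2 * s * s' / p))).
  rewrite ler_wpM2r ?(divr_ge0, mulr_ge0)//.
  by apply: le_trans e2 _; rewrite ler_wpM2l.
move: (q ^+ d) => z; rewrite le_eqVlt; apply/orP; left; apply/eqP.
by rewrite /x; field; rewrite !lt0r_neq0.
Qed.

End pairs.

(** * Random coefficients *)

Section random_coefficients.
Variables (R : realType) (p N : nat).
Implicit Types (S T : {set 'I_p}) (r : {ffun 'I_p * 'I_N -> bool}).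

Definition random_coef (rho : R) (nu : nat) S r (jk : 'I_p * 'I_N) : R :=
  rho * ((jk.1 \in S) && (jk.2 < nu)%N)%:R * (-1) ^+ r jk.

Lemma random_coef_sq rho nu S r jk :
  random_coef rho nu S r jk ^+ 2 =
  rho ^+ 2 * ((jk.1 \in S) && (jk.2 < nu)%N)%:R.
Proof.
rewrite /random_coef !exprMn sqrr_sign mulr1; congr (_ * _).
by case: (_ && _); rewrite ?expr1n ?expr0n.
Qed.

Lemma sum_ltn_ord nu M : (\sum_(k < M) (k < nu) = minn nu M)%N.
Proof.
elim: M => [|M IH]; first by rewrite big_ord0 minn0.
by rewrite big_ord_recr /= IH; case: (ltnP M nu) => h /=; lia.
Qed.

Lemma sum_coef_support S nu :
  \sum_(jk : 'I_p * 'I_N) ((jk.1 \in S) && (jk.2 < nu)%N)%:R =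
  (#|S| * minn nu N)%:R :> R.
Proof.
rewrite -(pair_bigA _ (fun j (k : 'I_N) => ((j \in S) && (k < nu)%N)%:R))/=.
transitivity (\sum_j ((j \in S)%:R * (minn nu N)%:R : R)).
  apply: eq_bigr => j _; case: (j \in S); last by rewrite mul0r big1.
  by rewrite mul1r -natr_sum sum_ltn_ord.
rewrite -mulr_suml natrM; congr (_ * _).
rewrite -sum1_card natr_sum [RHS]big_mkcond/=.
by apply: eq_bigr => j _; case: (_ \in _).
Qed.

Lemma random_coef_norm_sq rho nu S r : (nu <= N)%N ->
  \sum_jk random_coef rho nu S r jk * random_coef rho nu S r jk =
  rho ^+ 2 * (#|S|%:R * nu%:R).
Proof.
move=> nuN; under eq_bigr do rewrite -expr2 random_coef_sq.
by rewrite -mulr_sumr sum_coef_support (minn_idPl nuN) natrM.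
Qed.

Lemma random_coef_row_sq_le rho nu S r j :
  \sum_k random_coef rho nu S r (j, k) ^+ 2 <= rho ^+ 2 * nu%:R.
Proof.
under eq_bigr do rewrite random_coef_sq.
rewrite -mulr_sumr ler_wpM2l ?sqr_ge0// -natr_sum ler_nat.
apply: (@leq_trans (minn nu N)); last exact: geq_minl.
rewrite -sum_ltn_ord; apply: leq_sum => k _ /=.
by case: (j \in S).
Qed.

(** Two successive averages against a frozen coefficient family [theta]: over the
    signs by [random_signs_mgf], over the supports by the assumption on [w].  Only
    the common support and the common frequencies contribute. *)
Lemma random_coef_mgf (s nu nu' : nat) (w : {set 'I_p} -> R) (n rho rho' : R)
    T (theta : 'I_p * 'I_N -> R) :
  (forall S, 0 <= w S) ->
  (forall (l : R) T, 0 <= l ->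
     \sum_S w S * expR (l * #|S :&: T|%:R)
     <= expR ((expR l - 1) * (2 * s%:R * #|T|%:R / p%:R))) ->
  (forall jk, theta jk ^+ 2 <= rho' ^+ 2 * ((jk.1 \in T) && (jk.2 < nu')%N)%:R) ->
  forall l, l = 2 * n ^+ 2 * rho ^+ 2 * rho' ^+ 2 * (minn nu nu')%:R ->
  \sum_S w S * (2 ^- #|{: 'I_p * 'I_N}| *
    \sum_r expR (n * \sum_jk random_coef rho nu S r jk * theta jk))
  <= expR ((expR l - 1) * (2 * s%:R * #|T|%:R / p%:R)).
Proof.
move=> w0 wmgf theta_le l lE.
have l0 : 0 <= l.
  rewrite lE mulr_ge0// mulr_ge0 ?sqr_ge0// mulr_ge0 ?sqr_ge0//.
  by rewrite mulr_ge0// sqr_ge0.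
apply: le_trans (wmgf l T l0); apply: ler_sum => S _; rewrite ler_wpM2l//.
pose x (jk : 'I_p * 'I_N) := n * (rho * ((jk.1 \in S) && (jk.2 < nu)%N)%:R) * theta jk.
rewrite ler_pdivrMl ?exprn_gt0//.
rewrite (eq_bigr (fun r : {ffun _ -> bool} => expR (\sum_jk x jk * (-1) ^+ r jk))).
  apply: le_trans (random_signs_mgf x) _.
  rewrite ler_wpM2l ?exprn_ge0// ler_expR.
  have xE jk : x jk ^+ 2 <= n ^+ 2 * rho ^+ 2 * rho' ^+ 2 *
      ((jk.1 \in S :&: T) && (jk.2 < minn nu nu')%N)%:R.
    rewrite /x !exprMn inE leq_min.
    have := theta_le jk.
    case: (jk.1 \in S); last by rewrite /= expr0n/= !(mulr0, mul0r).
    case: (jk.2 < nu)%N; last by rewrite !andbF/= expr0n/= !(mulr0, mul0r).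
    by rewrite /= expr1n mulr1 => th; rewrite -[leRHS]mulrA ler_wpM2l// mulr_ge0 ?sqr_ge0.
  apply: (@le_trans _ _ (2 * \sum_(jk : 'I_p * 'I_N) (n ^+ 2 * rho ^+ 2 * rho' ^+ 2 *
      ((jk.1 \in S :&: T) && (jk.2 < minn nu nu')%N)%:R))).
    by rewrite ler_wpM2l// ler_sum.
  rewrite -mulr_sumr sum_coef_support lE natrM.
  set m := minn nu nu'.
  have mN : (minn m N)%:R <= m%:R :> R by rewrite ler_nat geq_minl.
  have -> : 2 * n ^+ 2 * rho ^+ 2 * rho' ^+ 2 * m%:R * #|S :&: T|%:R =
    2 * (n ^+ 2 * rho ^+ 2 * rho' ^+ 2 * (#|S :&: T|%:R * m%:R)) by ring.
  do 2 apply: ler_wpM2l => //; last exact: ler_wpM2l.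
  by rewrite mulr_ge0 ?sqr_ge0// mulr_ge0 ?sqr_ge0.
move=> r _; congr expR; rewrite mulr_sumr; apply: eq_bigr => jk _.
by rewrite /x /random_coef; ring.
Qed.

End random_coefficients.

(** * The second moment of the prior *)

Section prior.
Variables (R : realType) (p N n : nat) (V : finType) (kappa s nu : V -> nat).
Variables (G : V -> R) (w : V -> {set 'I_p} -> R) (A c t : R).
Hypotheses (p_gt0 : (0 < p)%N) (n_gt0 : (0 < n)%N) (V_gt0 : (0 < #|V|)%N).
Hypotheses (A_gt0 : 0 < A) (c_small : 0 < c <= 4^-1) (t_small : 0 <= t <= 2^-1).
Hypotheses (s_gt0 : forall v, (0 < s v)%N) (nu_gt0 : forall v, (0 < nu v)%N).
Hypothesis s_large : forall v, p%:R * A <= (s v)%:R ^+ 2.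
Hypothesis G_ge0 : forall v, 0 <= G v.
Hypothesis G_le : forall v,
  G v ^+ 2 <= 2 * (nu v)%:R * (p%:R * A / (s v)%:R ^+ 2) / n%:R ^+ 2.
Hypothesis kappa_inj : injective kappa.
Hypothesis nu_dyadic : forall v,
  (2 ^ kappa v < 2 * (nu v).+1)%N && ((nu v).+1 <= 2 ^ kappa v)%N.
Hypothesis w_ge0 : forall v S, 0 <= w v S.
Hypothesis w_sum : forall v, \sum_S w v S = 1.
Hypothesis w_card : forall v S, 0 < w v S -> #|S| = s v.
Hypothesis w_mgf : forall v (l : R) T, 0 <= l ->
  \sum_S w v S * expR (l * #|S :&: T|%:R)
  <= expR ((expR l - 1) * (2 * (s v)%:R * #|T|%:R / p%:R)).
Hypothesis A_le : 32 * c ^+ 4 * A <= t * ln (expR 1 * #|V|%:R).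

Local Notation index := (V * ({set 'I_p} * {ffun 'I_p * 'I_N -> bool}))%type.

(** This makes the squared norm of a drawn signal equal to [c^2 s G]. *)
Definition amplitude v : R := Num.sqrt (c ^+ 2 * G v / (nu v)%:R).

Definition prior_coef (i : index) : 'I_p * 'I_N -> R :=
  random_coef (amplitude i.1) (nu i.1) i.2.1 i.2.2.

Definition prior_weight (i : index) : R :=
  #|V|%:R^-1 * (w i.1 i.2.1 * 2 ^- #|{: 'I_p * 'I_N}|).

Lemma amplitude_sq v : amplitude v ^+ 2 = c ^+ 2 * G v / (nu v)%:R.
Proof. by rewrite sqr_sqrtr// divr_ge0// mulr_ge0// sqr_ge0. Qed.

Lemma prior_weight_ge0 i : 0 <= prior_weight i.
Proof. by rewrite mulr_ge0 ?invr_ge0// mulr_ge0 ?invr_ge0 ?exprn_ge0. Qed.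

Lemma prior_weight_gt0 i : 0 < prior_weight i -> #|i.2.1| = s i.1.
Proof.
move=> wi; apply: w_card; rewrite lt_neqAle w_ge0 andbT eq_sym.
by apply: contraTneq wi => w0; rewrite /prior_weight w0 mul0r mulr0 ltxx.
Qed.

Lemma prior_mean (F : index -> R) : \sum_i prior_weight i * F i =
  #|V|%:R^-1 * \sum_v \sum_S w v S * (2 ^- #|{: 'I_p * 'I_N}| *
    \sum_r F (v, (S, r))).
Proof.
transitivity (\sum_v \sum_Sr prior_weight (v, Sr) * F (v, Sr)).
  by rewrite pair_bigA; apply: eq_bigr => -[].
rewrite mulr_sumr; apply: eq_bigr => v _.
transitivity (\sum_S \sum_r prior_weight (v, (S, r)) * F (v, (S, r))).
  by rewrite pair_bigA; apply: eq_bigr => -[].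
rewrite mulr_sumr; apply: eq_bigr => S _.
rewrite !mulr_sumr; apply: eq_bigr => r _.
by rewrite /prior_weight /=; ring.
Qed.

Lemma prior_weight_sum : \sum_i prior_weight i = 1.
Proof.
rewrite (eq_bigr (fun i => prior_weight i * 1)); last by move=> i _; rewrite mulr1.
rewrite (prior_mean (fun=> 1)).
have two0 : 2 ^+ #|{: 'I_p * 'I_N}| != 0 :> R by rewrite expf_neq0.
rewrite (eq_bigr (fun=> 1)); last first.
  move=> v _; rewrite -[RHS](w_sum v); apply: eq_bigr => S _.
  by rewrite sumr_const card_ffun card_bool natrX mulVf// mulr1.
by rewrite /= sumr_const mulVf// pnatr_eq0 -lt0n.
Qed.

(** The average over the first draw is bounded for each possible second draw, so
    that the outer average costs nothing. *)
Lemma prior_chi2 :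
  \sum_i \sum_j prior_weight i * prior_weight j *
    expR (n%:R * \sum_jk prior_coef i jk * prior_coef j jk)
  <= 1 + 16 * t * expR 1.
Proof.
rewrite exchange_big/=.
under eq_bigr => j _.
  under eq_bigr => i _ do rewrite mulrAC [_ * prior_weight j]mulrC.
  rewrite -mulr_sumr.
  over.
rewrite -lee_fin; apply: convex_combination_le.
- exact: prior_weight_ge0.
- exact: prior_weight_sum.
move=> [v' [T r']] wj; rewrite lee_fin.
rewrite (prior_mean (fun i => expR (n%:R *
  \sum_jk prior_coef i jk * prior_coef (v', (T, r')) jk))).
have cardT : #|T| = s v' by exact: (prior_weight_gt0 wj).
have B0 : 0 <= 32 * c ^+ 4 * A.
  by case/andP: c_small => c0 _; rewrite mulr_ge0 ?ltW// mulr_gt0 ?exprn_gt0.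
have AB : 0 <= 32 * c ^+ 4 * A <= t * ln (expR 1 * #|V|%:R) by rewrite B0.
apply: le_trans (scale_average_le (kappa v') kappa_inj t_small AB V_gt0).
rewrite ler_wpM2l ?invr_ge0//; apply: ler_sum => v _.
have := @pair_exponent_le R A c p%:R n%:R (s v)%:R (s v')%:R (nu v)%:R (nu v')%:R
  (minn (nu v) (nu v'))%:R (G v) (G v') (scale_dist (kappa v) (kappa v')).
rewrite !ltr0n p_gt0 n_gt0 !s_gt0 !nu_gt0 A_gt0 !s_large !G_le.
have /andP[d1 d2] := nu_dyadic v; have /andP[d1' d2'] := nu_dyadic v'.
have := dyadic_ratio (nu_gt0 v) (nu_gt0 v') d1 d2 d1' d2'.
rewrite -(ler_nat R) !natrM !natrX => ratio.
case=> // l0 lle.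
have coef_le jk : prior_coef (v', (T, r')) jk ^+ 2 <=
    amplitude v' ^+ 2 * ((jk.1 \in T) && (jk.2 < nu v')%N)%:R.
  by rewrite random_coef_sq.
have := @random_coef_mgf R p N (s v) (nu v) (nu v') (w v) n%:R (amplitude v)
  (amplitude v') T _ (w_ge0 v) (@w_mgf v) coef_le _ erefl.
move/le_trans; apply.
by rewrite !amplitude_sq ler_expR cardT.
Qed.

End prior.

(** * The adaptive lower bound *)

Theorem theorem2 (R : realType) (C : R) (C_gt0 : 0 < C)
    (eta : R) (eta01 : 0 < eta < 1) :
  exists c_eta : R, 0 < c_eta /\
  forall (p n : nat) (p_gt0 : (0 < p)%N) (n_gt0 : (0 < n)%N)
    (H : set (R -> R)) (ip : (R -> R) -> (R -> R) -> R) (K K0 : R -> R -> R)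
    (mu : nat -> R) (psi : nat -> R -> R)
    (H_rkhs : is_rkhs H ip K)
    (H_mercer : exists mu' psi', mercer_expansion K mu' psi')
    (H0_rkhs : is_rkhs (orth_cst1 H) ip K0)
    (H0_mercer : mercer_expansion K0 mu psi)
    (H0_norm : spectral_norm (orth_cst1 H) ip mu psi)
    (mu1 : mu 1%N = 1)
    (d : measure_display) (Omega : measurableType d)
    (P : probability Omega R)
    (W : L2cube R p -> {RV P >-> measurableTypeR R})
    (W_noise : white_noise W)
    (A_asymp : asymp_with C (AH mu p n) (log_card R (Vtilde mu p n)))
    (n_large : ln (1 + p%:R * AH mu p n) <= n%:R / 2)
    (c : R) (c_gt0 : 0 < c) (c_lt : c < c_eta),
  ((1 - eta)%:E <=
   ereal_inf [set
     law W n (cst 0%R) [set y | phi y <> false] +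
     \big[maxe/-oo]_(1 <= s < p.+1 | large mu p n s)
       ereal_sup [set law W n f [set y | phi y <> true] | f in
         sparse_class (orth_cst1 H) ip p s `&`
         [set f | (c * psi_adapt mu p n s)%:E <= normL2 (leb_cube R p) f]]
     | phi in [set: {mfun @observation R p >-> bool}]])%E.
Proof.
have [eta_gt0 eta_lt1] := andP eta01.
exists (eta ^+ 2 / (100 * (C + 1))); split.
  by rewrite divr_gt0 ?exprn_gt0// mulr_gt0// addr_gt0.
move=> p n p_gt0 n_gt0 H ip K K0 mu psi H_rkhs H_mercer H0_rkhs H0_mercer
  H0_norm mu1 d Omega P W W_noise A_asymp n_large c c_gt0 c_lt.
have C1 : 0 < 100 * (C + 1) by rewrite mulr_gt0// addr_gt0.
have cC : c * (100 * (C + 1)) < eta ^+ 2 by rewrite -ltr_pdivlMr.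
have eta2 : eta ^+ 2 <= 1 by rewrite exprn_ile1// ltW.
have c_small : c <= 100^-1 by nra.
have mu_le k l : (0 < k)%N -> (k <= l)%N -> mu l <= mu k.
  exact: (mu_noninc H0_mercer).
have A_ge1 := AH_ge1 p_gt0 n_gt0 mu_le mu1.
have finV := finite_Vtilde p_gt0 n_gt0 mu_le mu1.
set A := AH mu p n in A_asymp n_large A_ge1 *.
have A_gt0 : 0 < A by exact: lt_le_trans A_ge1.
pose V := fset_set (Vtilde mu p n).
(* An empty set of scales would make log_card equal to ln 0 = 0, and A <= 0. *)
have V_gt0 : (0 < #|{: V}|)%N.
  rewrite -cardfE lt0n; apply/negP => /eqP V0.
  have [_] := A_asymp; rewrite /log_card -/V V0 mulr0 ln0// mulr0.
  by rewrite leNgt A_gt0.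
have scale v : v \in V -> exists ks : nat * nat,
    [/\ large_sparsities mu p n ks.2, v = (2 ^ ks.1)%N &
      (2 ^ ks.1 < 2 * nuH mu p n ks.2 A)%N && (nuH mu p n ks.2 A <= 2 ^ ks.1)%N].
  by rewrite in_fset_set// inE => -[k [s Ss ks] <-]; exists (k, s).
have [ks ksP] := choice (fun v : V => scale (val v) (valP v)).
pose kappa v := (ks v).1; pose s v := (ks v).2.
pose nu v := (nuH mu p n (s v) A).-1; pose G v := GammaH mu p n (s v) A.
have s_sparse v : (0 < s v <= p)%N by have [[]] := ksP v.
have s_gt0 v : (0 < s v)%N by have /andP[] := s_sparse v.
have s_large v : large mu p n (s v) by have [[]] := ksP v.
have s_sq v : p%:R * A <= (s v)%:R ^+ 2.
  have := s_large v; rewrite /large -/A => sl.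
  rewrite -[leLHS]sqr_sqrtr; last by rewrite mulr_ge0// ltW.
  by rewrite ler_sqr ?nnegrE ?sqrtr_ge0.
have kappa_inj : injective kappa.
  move=> v v' kk; apply/val_inj; have [_ -> _] := ksP v; have [_ -> _] := ksP v'.
  by rewrite -/(kappa v) kk.
have dimP v := effective_dimension p_gt0 n_gt0 mu_le mu1 n_large (s_gt0 v).
have nuE v : (nu v).+1 = nuH mu p n (s v) A.
  by rewrite prednK// (ltn_trans _ (nuH_gt1 p_gt0 n_gt0 mu_le mu1 n_large (s_gt0 v))).
have nu_gt0 v : (0 < nu v)%N by have [] := dimP v.
have mu_gt0 v : 0 < mu (nu v) by have [] := dimP v.
have G_ge0 v : 0 <= G v by have [] := dimP v.
have G_mu v : G v ^+ 2 <= 2 * mu (nu v) ^+ 2 by have [] := dimP v.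
have G_le v : G v ^+ 2 <= 2 * (nu v)%:R * (p%:R * A / (s v)%:R ^+ 2) / n%:R ^+ 2.
  by have [] := dimP v.
have nu_dyadic v :
    (2 ^ kappa v < 2 * (nu v).+1)%N && ((nu v).+1 <= 2 ^ kappa v)%N.
  by rewrite nuE; have [] := ksP v.
have [w wP] := choice (fun v => random_support R (s_sparse v)).
have w_ge0 v S : 0 <= w v S by have [] := wP v.
have w_sum v : \sum_S w v S = 1 by have [] := wP v.
have w_card v S : 0 < w v S -> #|S| = s v by have [_ _ + _] := wP v; apply.
have w_mgf v (l : R) T : 0 <= l ->
    \sum_S w v S * expR (l * #|S :&: T|%:R)
    <= expR ((expR l - 1) * (2 * (s v)%:R * #|T|%:R / p%:R)).
  by have [_ _ _] := wP v; apply.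
(* A common frequency cutoff; it is one of the nu v, hence mu N > 0. *)
pose N := (\max_v nu v)%N.
have nuN v : (nu v <= N)%N by exact: leq_bigmax.
have muN (k : 'I_N) : 0 < mu k.+1.
  have [v0 NE] := bigop.eq_bigmax nu V_gt0.
  by apply: lt_le_trans (mu_gt0 v0) _; apply: mu_le => //; rewrite -NE.
pose t := 32 * c ^+ 4 * C.
pose coef := @prior_coef R p N _ nu G c.
pose wt := @prior_weight R p N _ w.
pose f i : L2cube R p := Lfun_Sub (le1_2E R) (signal_L2 H0_mercer (coef i)).
apply: le_ereal_inf_tmp => _ [phi _ <-].
have c_small4 : 0 < c <= 4^-1 by rewrite c_gt0/=; lra.
have t_ge0 : 0 <= t by rewrite mulr_ge0 ?ltW// mulr_gt0// exprn_gt0.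
have c3 : c ^+ 3 <= 100^-1 ^+ 3 by rewrite lerXn2r ?nnegrE ?invr_ge0// ltW.
have tE : t = 32 * c ^+ 3 * (c * C) by rewrite /t; ring.
have cC100 : c * C <= eta ^+ 2 / 100 by lra.
have t_le : t <= 32 * 100^-1 ^+ 3 * (eta ^+ 2 / 100).
  rewrite tE; apply: ler_pM => //; last by rewrite ler_pM2l.
  - by rewrite mulr_ge0// exprn_ge0// ltW.
  - by rewrite mulr_ge0// ltW.
(* From exp (- 1/2) >= 1/2. *)
have e4 : expR 1 <= 4 :> R.
  have h : expR (2^-1) <= 2 :> R.
    rewrite -[2^-1]opprK expRN -[leRHS]invrK lef_pV2 ?posrE ?expR_gt0//.
    by have := expR_ge1Dx (- 2^-1 : R); lra.
  have -> : 1 = 2^-1 + 2^-1 :> R by lra.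
  by rewrite expRD; have := expR_ge0 (2^-1 : R); nra.
apply: (@mixture_lower_bound R p d Omega P W W_noise n n_gt0 _ wt f).
- exact: prior_weight_ge0.
- exact: prior_weight_sum.
- by [].
- have -> : \sum_i \sum_j wt i * wt j * expR (n%:R * dotL2 (leb_cube R p) (f i) (f j))
    = \sum_i \sum_j wt i * wt j * expR (n%:R * \sum_jk coef i jk * coef j jk).
    apply: eq_bigr => i _; apply: eq_bigr => j _.
    by rewrite (dotL2_signal H0_mercer H0_norm muN).
  have t_small : 0 <= t <= 2^-1 by rewrite t_ge0/=; nra.
  have A_le : 32 * c ^+ 4 * A <= t * ln (expR 1 * #|{: V}|%:R).
    rewrite /t -[leRHS]mulrA; apply: ler_wpM2l.
      by rewrite mulr_ge0// exprn_ge0// ltW.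
    by have [_] := A_asymp; rewrite /log_card -/V cardfE.
  have := @prior_chi2 R p N n _ kappa s nu G w A c t p_gt0 n_gt0 V_gt0 A_gt0
    c_small4 t_small s_gt0 nu_gt0 s_sq G_ge0 G_le kappa_inj nu_dyadic w_ge0
    w_sum w_card w_mgf A_le.
  move/le_trans; apply.
  rewrite lerD2l; have := expR_ge0 (1 : R); nra.
move=> i wi; have cardS : #|i.2.1| = s i.1 by exact: prior_weight_gt0 w_ge0 w_card i wi.
have rho2 : amplitude nu G c i.1 ^+ 2 * (nu i.1)%:R = c ^+ 2 * G i.1.
  by rewrite amplitude_sq// divfK// pnatr_eq0 -lt0n.
apply: le_trans; last first.
  apply: (@le_bigmax_seq _ _ _ _ _ (s i.1)); last exact: s_large.
  by rewrite mem_index_iota ltnS; exact: s_sparse.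
apply: ereal_sup_ubound; exists (signal psi (coef i)) => //; split.
- apply: (signal_sparse H0_rkhs H0_mercer H0_norm muN (S := i.2.1) (nu := nu i.1)).
  + by rewrite cardS.
  + exact: nu_gt0.
  + exact: mu_gt0.
  + by move=> j k jS; rewrite /coef /prior_coef /random_coef/= (negbTE jS) mulr0 mul0r.
  + move=> j k nuk; rewrite /coef /prior_coef /random_coef/= ltnNge nuk andbF.
    by rewrite mulr0 mul0r.
  + move=> j; apply: le_trans (random_coef_row_sq_le _ _ _ _ _) _.
    rewrite rho2 -(@ler_sqr _ (c ^+ 2 * G i.1)) ?nnegrE; last 2 first.
    * by rewrite mulr_ge0 ?sqr_ge0.
    * exact: ltW.
    rewrite exprMn; apply: (@le_trans _ _ (2^-1 * (2 * mu (nu i.1) ^+ 2))).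
      apply: ler_pM; rewrite ?sqr_ge0 ?G_mu//.
      have c2 : c ^+ 2 <= 2^-1 by nra.
      by have := sqr_ge0 c; nra.
    by rewrite mulrA mulVf// mul1r.
- rewrite /= normL2E; last exact: signal_L2 H0_mercer _.
  rewrite (dotL2_signal H0_mercer H0_norm muN) random_coef_norm_sq//.
  rewrite lee_fin /psi_adapt /psi_adapt_sq ltNge.
  have -> : Num.sqrt (p%:R * AH mu p n) <= (s i.1)%:R by exact: s_large.
  rewrite /= cardS mulrCA rho2 [in leRHS]mulrCA [leRHS]sqrtrM ?sqr_ge0// sqrtr_sqr.
  by rewrite (ger0_norm (ltW c_gt0)); exact: lexx.
Qed.
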